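(* Assume that $\lim_{p\searrow c} F(p)/(p-c)^{\nu+1}=\kappa$ for some constants $0<\nu<\infty$ and $0<\kappa<\infty$ (so that $u^*<\infty$). Then for all $b>0$, $$\limsup_{t\to\infty}P\{X_t>bt^{1-\alpha}\}\le \exp\bigl\{-A(\nu)^{-1}\kappa b^{\nu+2}\bigr\}$$ and $$\liminf_{t\to\infty}P\{X_t>bt^{1-\alpha}\}\ge \exp\bigl\{-A(\nu)(1+u^* )^{\nu+1}\kappa b^{\nu+2}\bigr\}.$$
   Context: Rates: $F$ is a probability distribution function supported on $(c,1]$, where $c>0$ is the left endpoint of the support: $F(p)=0$ for $p<c$, $F(c)=0$, $F(p)>0$ for $p>c$, $F(1)=1$. The rates $\{p_i\}_{i\le 0}$ are i.i.d. with distribution $F$. The critical gap is $u^*=\int_{(c,1]}\frac{c}{p-c}\,dF(p)$. Notation: $\alpha=\frac{1}{\nu+2}$, so $1-\alpha=\frac{\nu+1}{\nu+2}$, and $A(\nu)=\frac{(\nu+2)^{\nu+2}}{(\nu+1)^{\nu+1}}$. Process: particles are labeled by nonpositive integers, with positions $\cdots<\xi_{-2}(t)<\xi_{-1}(t)<\xi_0(t)$ in $\mathbf{Z}$ and initial positions $\xi_i(0)=i$ for $i\le 0$. Given the rates, each particle $i$ has an independent Poisson clock of rate $p_i$; whenever it rings, $\xi_i$ moves one step to the right provided the next site to the right is vacant (exclusion rule). $X_t=0\vee\sup\{k\ge 1:\xi_{-k+1}(t)>ct\}$ is the number of particles strictly beyond $ct$ at time $t$. $P$ is the annealed probability measure,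 under which both the rates and the Poisson clocks are random. *)

(* Defs.v *)
From HB Require Import structures.
From mathcomp Require Import all_boot all_order all_algebra.
From mathcomp Require Import finmap.
From mathcomp Require Import all_classical all_reals all_analysis.
Set Implicit Arguments.
Unset Strict Implicit.
Unset Printing Implicit Defensive.
Import Order.TTheory GRing.Theory Num.Theory.
Import numFieldNormedType.Exports.
Local Open Scope classical_set_scope.
Local Open Scope ring_scope.

(* Convention: the natural number k stands for the label -k, so label 0 is the
   rightmost particle and label k.+1 sits behind label k. *)

Section distribution_function.
Context {R : realType}.

(* c is the left endpoint of the support and is not an atom; the support is
   contained in ]c, 1]. *)
Definition supported_on_oc (F : R -> R) (c : R) : Prop :=
  [/\ forall x, x < c -> F x = 0, F c = 0, forall x, c < x -> 0 < F x & F 1 = 1].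

Definition critical_gap (F : cumulativeBounded (0 : R) (1 : R)) (c : R)
    : \bar R :=
  (\int[lebesgue_stieltjes_measure F]_(x in `]c, 1%R]) (c / (x - c))%:E)%E.

Definition alpha (nu : R) : R := (nu + 2)^-1.

Definition Aconst (nu : R) : R :=
  (nu + 2) `^ (nu + 2) / (nu + 1) `^ (nu + 1).

End distribution_function.

Section random_environment.
Context {R : realType} {d : measure_display} {T : measurableType d}.
Variable P : probability T R.

Definition mutually_independent (p : nat -> {RV P >-> R}) : Prop :=
  forall (J : {fset nat}) (A : nat -> set R), (forall k, measurable (A k)) ->
    P (\bigcap_(k in [set` J]) p k @^-1` A k) =
    (\prod_(k <- J) P (p k @^-1` A k))%E.

Definition iid_with_cdf (F : R -> R) (p : nat -> {RV P >-> R}) : Prop :=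
  (forall k x, cdf (p k) x = (F x)%:E) /\ mutually_independent p.

Definition rate_events (p : nat -> {RV P >-> R}) : set (set T) :=
  <<s \bigcup_k preimage_set_system setT (p k) measurable >>.

Definition counting_path (n : R -> nat) : Prop :=
  [/\ n 0 = 0%N,
      forall s t : R, 0 <= s -> s <= t -> (n s <= n t)%N
    & forall t : R, 0 <= t -> \forall s \near t^'+, n s = n t].

(* N k t is the number of rings of clock k during ]0, t].  The second conjunct
   says that, conditionally on the sigma-algebra generated by the rates, the
   increments of all clocks over disjoint time intervals are independent, those
   of clock k over ]s, t] being Poisson with parameter p k * (t - s): the
   conditional probability is tested against every event B of that
   sigma-algebra.  Intervals are nondegenerate since poisson_pmf has a dummy value
   at nonpositive parameters. *)
Definition poisson_clocks_given_rates (p : nat -> {RV P >-> R})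
    (N : nat -> R -> {RV P >-> nat}) : Prop :=
  {ae P, forall w, forall k, counting_path (fun t => N k t w)} /\
  forall (n m : nat) (s : nat -> R) (j : nat -> nat -> nat) (B : set T),
    0 <= s 0%N -> (forall i, s i < s i.+1) -> rate_events p B ->
    P (B `&` [set w | forall k i, (k < n)%N -> (i < m)%N ->
                       N k (s i.+1) w = (N k (s i) w + j k i)%N]) =
    (\int[P]_(w in B) (\prod_(k < n) \prod_(i < m)
        poisson_pmf (p k w * (s i.+1 - s i)) (j k i))%:E)%E.

End random_environment.

Section exclusion.
Context {R : realType}.
Implicit Types (n : nat -> R -> nat) (x : nat -> R -> int).

Definition vacant x (s : R) (z : int) : Prop := forall k, x k s <> z.

(* At each t > 0, s just before t plays the role of t-: clock k rings at t iff
   it has jumped between s and t, and particle k then steps to the right iff the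
   next site is vacant at t-.  Trajectories are right-continuous. *)
Definition exclusion_path n x : Prop :=
  forall k,
    [/\ x k 0 = - k%:Z,
        forall t : R, 0 <= t -> \forall s \near t^'+, x k s = x k t
      & forall t : R, 0 < t -> \forall s \near t^'-,
          x k t = if `[< (n k s < n k t)%N /\ vacant x s (x k s + 1) >]
                  then x k s + 1 else x k s].

(* The label -k + 1 of the k-th particle is encoded by k.-1. *)
Definition num_beyond (c : R) x (t : R) : \bar R :=
  maxe 0%E (ereal_sup
    [set (k%:R : R)%:E | k in [set k : nat |
                                (1 <= k)%N /\ c * t < (x k.-1 t)%:~R]]).

End exclusion.

(* P is the annealed measure: p and N live on the same probability space. *)
Record disordered_exclusion (R : realType) (d : measure_display)
    (T : measurableType d) (P : probability T R) (F : R -> R)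
    (p : nat -> {RV P >-> R}) (N : nat -> R -> {RV P >-> nat})
    (xi : nat -> R -> T -> int) : Prop := {
  rates_iid : iid_with_cdf F p ;
  clocks_poisson : poisson_clocks_given_rates p N ;
  positions_measurable : forall (k : nat) (t : R) (z : int), 0 <= t ->
    measurable [set w | xi k t w = z] ;
  positions_dynamics : {ae P, forall w,
    exclusion_path (fun k t => N k t w) (fun k t => xi k t w)}
}.

(* Main.v *)
Require Import Defs.
From HB Require Import structures.
From mathcomp Require Import all_boot all_order all_algebra.
From mathcomp Require Import finmap.
From mathcomp Require Import all_classical all_reals all_analysis.
From mathcomp Require Import measurable_realfun.
From mathcomp Require Import ring lra zify.
(* Since the event X_t > b t^(1-alpha) says that particle n = floor(b t^(1-alpha))
   is beyond ct, everything reduces to the position of one particle.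

   Upper bound: particle n stays behind each particle j <= n moving freely, so all
   the clocks j <= n must ring more than ct + n times.  Rates within s b t^(-alpha)
   of c, s < 1, make this unlikely by the Chernoff bound, hence essentially all
   n + 1 independent rates must exceed c + s b t^(-alpha).

   Lower bound: on the event that all rates exceed c + y t^(-alpha), bound the
   process from below by a discrete-time exclusion process in which each particle
   jumps at most once per step, then put in front of it a leader jumping with a
   probability corresponding to a speed lambda slightly larger than c, and start
   the gaps between particles from their stationary law.  The gaps form a tandem of
   queues for which a product of (modified) geometric laws is stationary (Burke),
   so the lag of particle n behind the leader is a sum of independent variables of
   total mean about n u^*, which beats (lambda - c) t only if lambda is too small.
   The Chernoff bound for this sum has product form in the rates, so it can be
   averaged over them by independence. *)

Set Implicit Arguments.
Unset Strict Implicit.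
Unset Printing Implicit Defensive.
Import Order.TTheory GRing.Theory Num.Theory.
Import numFieldNormedType.Exports.
Local Open Scope classical_set_scope.
Local Open Scope ring_scope.

(** * Tandem queues and the discrete exclusion process *)

(** The value of alpha makes the problem critical: with tau = t^(-alpha) and S = t^(1-alpha) = t tau
    one has S tau^(nu+1) = 1, so among order S rates the expected number within order tau of c is of
    order one, and the probability that there is none has a limit strictly between 0 and 1. Let u be
    the critical gap. The factor 1 + u is the deficit of particle n, about b S: one n for its
    starting site -n, and n u for its lag. A leader of speed c + z tau gains z S over ct, so any z >
    (1 + u) b will do, and then any y > z as lower bound for the rates. Both estimates thus come out
    with an arbitrary constant > 1 in place of A(nu), and A(nu) enters through A(nu) > 1. No
    discrete process is built on a probability space: its expectations are nested finite averages.
    The stationary law has infinite support, so queue lengths are truncated below L; Burke's theorem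
    becomes an inequality that costs one level per step, and L tends to infinity with the number of
    steps fixed. *)

Section bernoulli_expectation.
Context {R : realType}.
Implicit Types (q : R) (qs : seq R).

Definition bern_mean q (f : bool -> R) : R := q * f true + (1 - q) * f false.

Fixpoint bits_mean qs (f : seq bool -> R) : R :=
  if qs is q :: qs' then bern_mean q (fun b => bits_mean qs' (fun bs => f (b :: bs)))
  else f [::].

Definition is_prob q := (0 <= q) && (q <= 1).

Lemma bern_mean_le q f g : is_prob q -> (forall b, f b <= g b) ->
  bern_mean q f <= bern_mean q g.
Proof.
move=> /andP[q0 q1] fg; rewrite /bern_mean lerD// ler_wpM2l// subr_ge0//.
Qed.

Lemma bern_meanD q f g :
  bern_mean q (fun b => f b + g b) = bern_mean q f + bern_mean q g.
Proof. rewrite /bern_mean; ring. Qed.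

Lemma bern_mean_cst q k : bern_mean q (fun=> k) = k.
Proof. rewrite /bern_mean; ring. Qed.

Lemma bern_mean_ge0 q f : is_prob q -> (forall b, 0 <= f b) -> 0 <= bern_mean q f.
Proof. by move=> hq f0; rewrite -(bern_mean_cst q 0) bern_mean_le. Qed.

Lemma eq_bern_mean q f g : f =1 g -> bern_mean q f = bern_mean q g.
Proof. by move=> fg; rewrite /bern_mean !fg. Qed.

Lemma eq_bits_mean qs f g : f =1 g -> bits_mean qs f = bits_mean qs g.
Proof.
elim: qs f g => [|q qs ih] f g fg /=; first exact: fg.
by apply: eq_bern_mean => b; apply: ih => bs; exact: fg.
Qed.

Lemma bits_mean_le qs f g : all is_prob qs ->
  (forall bs, size bs = size qs -> f bs <= g bs) ->
  bits_mean qs f <= bits_mean qs g.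
Proof.
elim: qs f g => [|q qs ih] f g /=; first by move=> _; exact.
move=> /andP[hq hqs] fg; apply: bern_mean_le => // b; apply: ih => // bs sbs.
by apply: fg => /=; rewrite sbs.
Qed.

Lemma bits_meanD qs f g :
  bits_mean qs (fun b => f b + g b) = bits_mean qs f + bits_mean qs g.
Proof.
elim: qs f g => [//|q qs ih] f g /=.
by rewrite -bern_meanD; apply: eq_bern_mean => b; rewrite ih.
Qed.

Lemma bits_mean_cst qs k : bits_mean qs (fun=> k) = k.
Proof.
elim: qs => [//|q qs ih] /=; rewrite -[RHS](bern_mean_cst q).
exact: eq_bern_mean.
Qed.

Lemma bits_mean_ge0 qs f : all is_prob qs -> (forall bs, 0 <= f bs) ->
  0 <= bits_mean qs f.
Proof. by move=> hq f0; rewrite -(bits_mean_cst qs 0) bits_mean_le. Qed.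

End bernoulli_expectation.

(** * Stationary queues in tandem, truncated *)

Section tandem_queue.
Context {R : realType}.
Variable a : R.
Implicit Types (q : R) (qs : seq R) (L : nat).

(* At each step a customer arrives with probability a and, if the queue was not
   empty before the arrival, one is served with probability q; stat_queue is the
   stationary law of the queue length. *)
Definition load q : R := a * (1 - q) / (q * (1 - a)).

Definition stat_queue q (j : nat) : R :=
  if j is j'.+1 then (1 - a / q) * (a / (q * (1 - a))) * load q ^+ j'
  else 1 - a / q.
#[local] Arguments stat_queue : simpl never.

(** The sum stops at L so that only finite sums occur. A step raises a length by at most one, hence
    the inequalities below that pass from L to [L.+1]. *)
Definition queue_mean L q (f : nat -> R) := \sum_(j < L) stat_queue q j * f j.

Fixpoint queues_mean L qs (f : seq nat -> R) : R :=
  if qs is q :: qs' then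
    queue_mean L q (fun j => queues_mean L qs' (fun js => f (j :: js)))
  else f [::].

(** In the exclusion picture an entry of [eta] is the gap in front of a particle, a service is a
    jump of that particle, and the arrival at the first queue is a jump of the leader. *)
Fixpoint tandem (arrival : bool) (eta : seq nat) (bs : seq bool) : seq nat :=
  match eta, bs with
  | e :: eta', b :: bs' =>
      let served := b && (0 < e)%N in
      (e + arrival - served)%N :: tandem served eta' bs'
  | _, _ => [::]
  end.

Definition stable q := [&& 0 < a, a < q & q < 1].

Lemma stat_queue_ge0 q j : stable q -> 0 <= stat_queue q j.
Proof.
move=> /and3P[a0 aq q1].
have q0 : 0 < q by apply: lt_trans aq.
have h : 0 <= 1 - a / q by rewrite subr_ge0 ler_pdivrMr// mul1r ltW.
have a1 : 0 <= 1 - a by lra.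
have q1' : 0 <= 1 - q by lra.
case: j => [|j]; first exact: h.
rewrite /stat_queue !mulr_ge0 ?exprn_ge0 ?invr_ge0 ?mulr_ge0 ?invr_ge0 ?mulr_ge0 //; exact: ltW.
Qed.

(* Detailed balance. *)
Lemma stat_queueS q j : stable q ->
  stat_queue q j.+1 * (q * (1 - a)) =
  stat_queue q j * (a * (if j is 0%N then 1 else 1 - q)).
Proof.
move=> /and3P[a0 aq q1].
have q0 : q != 0 by lra.
have a1 : 1 - a != 0 by lra.
case: j => [|j]; rewrite /stat_queue; first by rewrite expr0; field; rewrite q0 a1.
by rewrite exprS /load; field; rewrite q0 a1.
Qed.

(** By detailed balance the pair (new length, departure) has the law of (length, independent
    arrival). In the truncated sum all flows between consecutive levels cancel, by induction on L,
    except the one across the truncation level. *)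
Lemma queue_mean_step L q (g : nat -> bool -> R) : stable q ->
  queue_mean L.+1 q (fun j => bern_mean a (fun b => bern_mean q (fun s =>
    let served := s && (0 < j)%N in g (j + b - served)%N served))) =
  queue_mean L.+1 q (fun j => bern_mean a (g j)) +
  stat_queue q L.+1 * (q * (1 - a)) * (g L.+1 false - g L true).
Proof.
move=> hq; rewrite /queue_mean; elim: L => [|L ih].
  rewrite !big_ord_recr !big_ord0 /= (stat_queueS 0 hq) /bern_mean /=.
  rewrite ?andbT ?andbF /= ?addn0 ?subn0 ?add0n; ring.
rewrite big_ord_recr ih [in RHS]big_ord_recr /=.
move: (\sum_(j < L.+1) stat_queue q j * bern_mean a (g j)) => S {ih}.
rewrite (stat_queueS L.+1 hq) /bern_mean /=.
rewrite ?addn0 ?addn1 ?subn0 ?subn1 /=; ring.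
Qed.

(** The boundary term of [queue_mean_step] is absorbed by the extra level on the right, because q <=
    1 and g is nonnegative. *)
Lemma queue_mean_burke L q (g : nat -> bool -> R) : stable q ->
  (forall j b, 0 <= g j b) ->
  queue_mean L q (fun j => bern_mean a (fun b => bern_mean q (fun s =>
    let served := s && (0 < j)%N in g (j + b - served)%N served))) <=
  queue_mean L.+1 q (fun j => bern_mean a (g j)).
Proof.
move=> hq g0; have /and3P[a0 aq q1] := hq; case: L => [|L].
  rewrite /queue_mean big_ord0 sumr_ge0// => j _.
  by rewrite mulr_ge0 ?stat_queue_ge0// bern_mean_ge0// /is_prob; lra.
rewrite queue_mean_step// [leRHS]big_ord_recr /= lerD2l /bern_mean.
rewrite -mulrA ler_wpM2l ?stat_queue_ge0//.
apply: (@le_trans _ _ (q * (1 - a) * g L.+1 false)).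
  by rewrite ler_wpM2l ?gerBl// mulr_ge0; lra.
apply: (@le_trans _ _ (1 * (1 - a) * g L.+1 false)).
  by rewrite !ler_wpM2r//; lra.
by rewrite mul1r lerDr mulr_ge0//; lra.
Qed.

Lemma queue_mean_le L q f g : stable q -> (forall j, f j <= g j) ->
  queue_mean L q f <= queue_mean L q g.
Proof.
by move=> hq fg; apply: ler_sum => j _; rewrite ler_wpM2l ?stat_queue_ge0.
Qed.

Lemma eq_queue_mean L q f g : f =1 g -> queue_mean L q f = queue_mean L q g.
Proof. by move=> fg; apply: eq_bigr => j _; rewrite fg. Qed.

Lemma eq_queues_mean L qs f g : f =1 g -> queues_mean L qs f = queues_mean L qs g.
Proof.
elim: qs f g => [|q qs ih] f g fg /=; first exact: fg.
by apply: eq_queue_mean => j; apply: ih => js; exact: fg.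
Qed.

Lemma queues_mean_le L qs f g : all stable qs ->
  (forall js, size js = size qs -> f js <= g js) ->
  queues_mean L qs f <= queues_mean L qs g.
Proof.
elim: qs f g => [|q qs ih] f g /=; first by move=> _; exact.
move=> /andP[hq hqs] fg; apply: queue_mean_le => // j; apply: ih => // js sjs.
by apply: fg => /=; rewrite sjs.
Qed.

Lemma queues_mean_lin L qs x y f g :
  queues_mean L qs (fun js => x * f js + y * g js) =
  x * queues_mean L qs f + y * queues_mean L qs g.
Proof.
elim: qs f g => [//|q qs ih] f g /=.
rewrite /queue_mean !mulr_sumr -big_split; apply: eq_bigr => j _ /=.
by rewrite ih; ring.
Qed.

Lemma queues_meanZ L qs x f :
  queues_mean L qs (fun js => x * f js) = x * queues_mean L qs f.
Proof.
rewrite -[RHS]addr0 -(mul0r (queues_mean L qs f)) -queues_mean_lin.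
by apply: eq_queues_mean => js; rewrite mul0r addr0.
Qed.

Lemma queues_mean_ge0 L qs f : all stable qs -> (forall js, 0 <= f js) ->
  0 <= queues_mean L qs f.
Proof.
move=> hq f0; apply: le_trans (queues_mean_le L hq (fun js _ => f0 js)).
have := queues_mean_lin L qs 0 0 (fun=> 0) (fun=> 0).
by rewrite !mul0r addr0 => ->.
Qed.

(* Burke's theorem: the stationary queues are independent of the output of the
   preceding ones, which is again a Bernoulli arrival process. *)
Lemma tandem_burke L qs (g : seq nat -> R) : all stable qs -> is_prob a ->
  (forall js, 0 <= g js) ->
  bern_mean a (fun b => queues_mean L qs (fun js =>
     bits_mean qs (fun bs => g (tandem b js bs)))) <=
  queues_mean L.+1 qs g.
Proof.
move=> + ha; elim: qs g => [|q qs ih] g /=; first by rewrite bern_mean_cst.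
move=> /andP[hq hqs] g0.
pose G e (b : bool) := queues_mean L qs (fun js =>
  bits_mean qs (fun bs => g (e :: tandem b js bs))).
rewrite [leLHS](_ : _ = queue_mean L q (fun j => bern_mean a (fun b =>
  bern_mean q (fun s => let served := s && (0 < j)%N in
    G (j + b - served)%N served)))); last first.
  rewrite /bern_mean /queue_mean !mulr_sumr -big_split; apply: eq_bigr => j _.
  by rewrite /= !queues_mean_lin /G; ring.
apply: le_trans (queue_mean_burke _ hq _) _.
  move=> e b; apply: queues_mean_ge0 => // js; apply: bits_mean_ge0 => //.
  apply: sub_all hqs => q' /and3P[? ? ?]; rewrite /is_prob; lra.
by apply: queue_mean_le => // e; apply: ih.
Qed.

End tandem_queue.

(** * Tandem networks fed by Bernoulli arrivals *)

Section chains.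
Context {R : realType}.
Variables (a : R) (qs : seq R).

(** [l] accumulates the arrivals, that is the jumps of the leader, and [eta] lists the queue
    lengths. *)
Fixpoint network_mean (M : nat) (g : nat -> seq nat -> R) (l : nat) (eta : seq nat) : R :=
  if M is M'.+1 then
    bern_mean a (fun b => bits_mean qs (fun bs =>
      network_mean M' g (l + b)%N (tandem b eta bs)))
  else g l eta.

Hypotheses (hqs : all (stable a) qs) (ha : is_prob a).

Let hps : all is_prob qs.
Proof.
apply: sub_all hqs => q /and3P[? ? ?]; rewrite /is_prob; lra.
Qed.

Lemma network_mean_lin M f g l eta :
  network_mean M (fun l eta => f l eta + g l eta) l eta =
  network_mean M f l eta + network_mean M g l eta.
Proof.
elim: M l eta => [//|M ih] l eta /=.
rewrite -bern_meanD; apply: eq_bern_mean => b.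
by rewrite -bits_meanD; apply: eq_bits_mean => bs.
Qed.

Lemma network_mean_arrivals M k s l eta :
  network_mean M (fun l _ => k * s ^+ l) l eta = k * s ^+ l * (1 - a + a * s) ^+ M.
Proof.
elim: M l eta => [|M ih] l eta /=; first by rewrite mulr1.
under eq_bern_mean => b do under eq_bits_mean => bs do rewrite ih.
under eq_bern_mean => b do rewrite bits_mean_cst.
rewrite /bern_mean addn0 addn1 !exprS; ring.
Qed.

Lemma network_mean_ge0 M g l eta : (forall l eta, 0 <= g l eta) ->
  0 <= network_mean M g l eta.
Proof.
move=> g0; elim: M l eta => [//|M ih] l eta /=.
by apply: bern_mean_ge0 => // b; apply: bits_mean_ge0.
Qed.

(** A function of the queue lengths alone does not see [l], so each step is one use of
    [tandem_burke], and M steps cost M levels of truncation. *)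
Lemma network_mean_stationary L M (g : seq nat -> R) l : (forall js, 0 <= g js) ->
  queues_mean a L qs (network_mean M (fun _ => g) l) <= queues_mean a (L + M) qs g.
Proof.
move=> g0; elim: M L l => [|M ih] L l; first by rewrite addn0.
have Gl l' l'' eta : network_mean M (fun _ => g) l' eta =
    network_mean M (fun _ => g) l'' eta.
  elim: M {ih} l' l'' eta => [//|M ih] l' l'' eta /=.
  by apply: eq_bern_mean => b; apply: eq_bits_mean.
rewrite addnS -addSn; apply: le_trans (ih L.+1 l).
have E (b : bool) : queues_mean a L qs (fun eta => bits_mean qs (fun bs =>
      network_mean M (fun=> g) (l + b)%N (tandem b eta bs))) =
    queues_mean a L qs (fun eta => bits_mean qs (fun bs =>
      network_mean M (fun=> g) l (tandem b eta bs))).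
  by apply: eq_queues_mean => eta; apply: eq_bits_mean => bs; exact: Gl.
apply: le_trans (tandem_burke _ hqs ha _); last first.
  by move=> js; apply: network_mean_ge0.
by rewrite /= /bern_mean queues_mean_lin (E true) (E false).
Qed.

End chains.

(** * Generating function of the stationary queue lengths *)

Section generating_function.
Context {R : realType}.
Variable a : R.
Implicit Types (q s : R) (qs : seq R).

(** The exact generating function at s has a (1 - q) / (q - a) in the denominator. Dropping the
    factor 1 - q gives an upper bound governed by a / (q - a), the discrete form of the integrand c
    / (p - c) of the critical gap. *)
Definition queue_gen s q : R := (1 + (s - 1) * a) / (1 - (s - 1) * (a / (q - a))).

Lemma geometric_sum_le (x : R) L : 0 <= x -> x < 1 -> \sum_(j < L) x ^+ j <= (1 - x)^-1.
Proof.
move=> x0 x1; have h : 0 < 1 - x by rewrite subr_gt0.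
rewrite -(ler_pM2l h) divff ?gt_eqF// -opprB mulNr -subrX1 opprB gerBl.
exact: exprn_ge0.
Qed.

Lemma queue_mean_gen L q s : stable a q -> 1 <= s -> (s - 1) * a < q - a ->
  queue_mean a L q (fun j => s ^+ j) <= queue_gen s q.
Proof.
move=> hq s1 sa; have /and3P[a0 aq q1] := hq.
have q0 : 0 < q by apply: lt_trans aq.
have qa : 0 < q - a by rewrite subr_gt0.
have a1 : 0 < 1 - a by lra.
have d0 : 0 < q * (1 - a) - a * (1 - q) * s.
  suff : (s - 1) * (a * (1 - q)) < q - a by nra.
  by apply: le_lt_trans sa; rewrite ler_wpM2l ?subr_ge0// ler_piMr; lra.
have rs1 : load a q * s < 1.
  rewrite /load mulrAC ltr_pdivrMr ?mulr_gt0// mul1r; lra.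
have rs0 : 0 <= load a q * s.
  by rewrite mulr_ge0 ?(le_trans _ s1)// /load divr_ge0 ?mulr_ge0 ?ltW//; lra.
have h0 : 0 <= 1 - a / q by rewrite subr_ge0 ler_pdivrMr// mul1r ltW.
have s0 : 0 <= s by lra.
apply: (@le_trans _ _ ((1 - a / q) * (1 + a / (q * (1 - a)) * s * (1 - load a q * s)^-1))).
  case: L => [|L]; rewrite /queue_mean.
    rewrite big_ord0 !mulr_ge0// addr_ge0// !mulr_ge0// ?invr_ge0 ?subr_ge0 ltW//.
    by rewrite mulr_gt0.
  rewrite big_ord_recl expr0 mulr1 mulrDr mulr1 -[stat_queue a q _]/(1 - a / q) lerD2l.
  rewrite (eq_bigr (fun j : 'I_L =>
    (1 - a / q) * (a / (q * (1 - a)) * s) * (load a q * s) ^+ j)); last first.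
    by move=> j _; rewrite lift0 /stat_queue /= exprS [in RHS]exprMn; ring.
  rewrite -mulr_sumr [leRHS]mulrA; apply: ler_wpM2l; last exact: geometric_sum_le.
  by rewrite mulr_ge0// mulr_ge0// divr_ge0// ?mulr_ge0// ltW.
rewrite [leLHS](_ : _ = (1 + (s - 1) * a) * ((q - a) / (q * (1 - a) - a * (1 - q) * s))); last first.
  rewrite /load; field.
  by rewrite !gt_eqF//.
rewrite /queue_gen ler_wpM2l//; first by rewrite addr_ge0// mulr_ge0; lra.
have -> : 1 - (s - 1) * (a / (q - a)) = (q - a - (s - 1) * a) / (q - a).
  by field; rewrite gt_eqF.
have h : 0 <= a * q * (s - 1) by rewrite mulr_ge0 ?mulr_ge0; lra.
rewrite invf_div ler_pM2l// lef_pV2 ?posrE//; lra.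
Qed.

Lemma queues_mean_gen L qs s : all (stable a) qs -> 1 <= s ->
  all (fun q => (s - 1) * a < q - a) qs ->
  queues_mean a L qs (fun js => s ^+ sumn js) <= \prod_(q <- qs) queue_gen s q.
Proof.
elim: qs => [|q qs ih] /=; first by rewrite big_nil expr0.
move=> /andP[hq hqs] s1 /andP[sq sqs]; rewrite big_cons.
rewrite [leLHS](_ : _ = queue_mean a L q (fun j => s ^+ j) *
    queues_mean a L qs (fun js => s ^+ sumn js)); last first.
  rewrite /queue_mean mulr_suml; apply: eq_bigr => j _; rewrite -mulrA; congr (_ * _).
  rewrite -queues_meanZ; apply: eq_queues_mean => js.
  by rewrite -exprD.
apply: ler_pM; last exact: ih.
- rewrite sumr_ge0// => j _; rewrite mulr_ge0 ?stat_queue_ge0// exprn_ge0//; lra.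
- by apply: queues_mean_ge0 => // js; rewrite exprn_ge0//; lra.
- exact: queue_mean_gen.
Qed.

(** Since [load a q] < 1, the mass lost by truncation decays geometrically in L. This removes the
    truncation at the end of [tasep_mean_tail]. *)
Lemma queues_mean_mass qs : all (stable a) qs ->
  queues_mean a L qs (fun=> 1) @[L --> \oo] --> (1 : R).
Proof.
elim: qs => [|q qs ih] /=; first by move=> _; exact: cvg_cst.
move=> /andP[hq hqs]; have /and3P[a0 aq q1] := hq.
have q0 : 0 < q by apply: lt_trans aq.
have E L : queue_mean a L.+1 q (fun=> 1) = 1 - a / q * load a q ^+ L.
  elim: L => [|L ihL].
    by rewrite /queue_mean big_ord_recr big_ord0 /= expr0 !mulr1 add0r.
  move: ihL; rewrite /queue_mean => ihL; rewrite big_ord_recr /= ihL /stat_queue exprS.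
  have [qn an] : q != 0 /\ 1 - a != 0 by split; lra.
  by rewrite /load; field; rewrite qn an.
have rho : `|load a q| < 1.
  have a1 : 0 < q * (1 - a) by rewrite mulr_gt0//; lra.
  rewrite ger0_norm ?divr_ge0 ?mulr_ge0 ?ltW//; try lra.
  rewrite ltr_pdivrMr//; nra.
rewrite [X in X @ _](_ : _ = fun L => queue_mean a L q (fun=> 1) *
    queues_mean a L qs (fun=> 1)); last first.
  by apply/funext => L; rewrite /queue_mean mulr_suml; apply: eq_bigr => j _; rewrite mulr1.
have cq : queue_mean a L q (fun=> 1) @[L --> \oo] --> (1 : R).
  rewrite -cvg_shiftS /=; under eq_fun do rewrite E.
  have h1 : (fun L => a / q * load a q ^+ L) @ \oo --> (a / q * 0 : R).
    by apply: cvgM; [exact: cvg_cst|exact: cvg_expr].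
  have := cvgB (cvg_cst (1 : R)) h1; rewrite mulr0 subr0; exact.
by have := cvgM cq (ih hqs); rewrite mulr1; exact.
Qed.

End generating_function.

(** * Discrete exclusion process and its comparison with the queues *)

Section discrete_exclusion.
Context {R : realType}.
Implicit Types (xs eta : seq nat) (bs : seq bool).

(* xs lists the numbers of jumps made so far, so the site in front of a particle
   is vacant iff its predecessor, which made X jumps, is ahead in this count. *)
Fixpoint exclusion_step (X : nat) xs bs : seq nat :=
  match xs, bs with
  | x :: xs', b :: bs' => (x + (b && (x < X)))%N :: exclusion_step x xs' bs'
  | _, _ => [::]
  end.

(** The rightmost particle is never blocked: its fictitious predecessor is one jump ahead of it. *)
Definition tasep_step xs bs := exclusion_step (head 0%N xs).+1 xs bs.

Fixpoint tasep_mean (qs : seq R) (M : nat) (g : seq nat -> R) xs : R :=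
  if M is M'.+1 then
    bits_mean qs (fun bs => tasep_mean qs M' g (tasep_step xs bs))
  else g xs.

(** With a leader at [l], the comparison particles have jump counts [l] minus the partial sums of
    the gaps [eta]; each must be at most the actual count. The counts are integers since they may be
    negative. *)
Fixpoint behind (l : int) eta xs : bool :=
  match eta, xs with
  | [::], [::] => true
  | e :: eta', x :: xs' => (l - e%:Z <= x%:Z) && behind (l - e%:Z) eta' xs'
  | _, _ => false
  end.

(** Both systems use the same bits, so the order can only break at a particle with x = l - e that is
    served in the queue picture. Then e > 0, and either x < X by hypothesis, or x < l <= X: the
    actual particle is free to jump as well. The first alternative serves the rightmost particle,
    the second all the others. *)
Lemma behind_step l eta xs bs (b : bool) X :
  behind l eta xs -> size bs = size xs -> (head 0%N xs < X)%N || (l <= X%:Z) ->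
  behind (l + b%:Z) (tandem b eta bs) (exclusion_step X xs bs).
Proof.
elim: eta l xs bs b X => [|e eta ih] l [|x xs] [|s bs] b X //=.
move=> /andP[lex h] [sbs] hX.
have -> : l + b%:Z - (e + b - (s && (0 < e)))%N%:Z =
    l - e%:Z + (s && (0 < e)%N)%:Z.
  by case: s; case: e {ih h lex} => [|e] /=; lia.
apply/andP; split; last by apply: ih => //; rewrite lex orbT.
by move: hX lex; case: s; case: (ltnP x X); case: e {ih h} => [|e] /=; lia.
Qed.

Lemma size_tasep_step xs bs : size bs = size xs -> size (tasep_step xs bs) = size xs.
Proof.
rewrite /tasep_step; move: (_.+1) => X.
by elim: xs bs X => [|x xs ih] [|b bs] X //= [] /ih ->.
Qed.

(** The exclusion process ignores the leader's bit, so it can be averaged over that bit for free;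
    the remaining bits are shared and [behind_step] preserves the order. *)
Lemma tasep_mean_le_network (a : R) qs M g h l eta xs :
  all (stable a) qs -> is_prob a ->
  (forall (l : nat) eta xs, size xs = size qs -> behind l%:Z eta xs ->
    g xs <= h l eta) ->
  size xs = size qs -> behind l%:Z eta xs ->
  tasep_mean qs M g xs <= network_mean a qs M h l eta.
Proof.
move=> hqs ha gh; elim: M l eta xs => [|M ih] l eta xs sxs hb /=; first exact: gh.
have hps : all is_prob qs.
  by apply: sub_all hqs => q /and3P[? ? ?]; rewrite /is_prob; lra.
rewrite -[leLHS](bern_mean_cst a); apply: bern_mean_le => // b.
apply: bits_mean_le => // bs sbs.
have hb' : behind (l + b)%N%:Z (tandem b eta bs) (tasep_step xs bs).
  by rewrite PoszD; apply: behind_step; rewrite ?sbs// ltnSn.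
by apply: ih => //; rewrite size_tasep_step ?sbs.
Qed.

Lemma behind_last l eta xs (y : nat) : l <= y%:Z -> behind l eta xs ->
  l <= (last y xs + sumn eta)%N%:Z.
Proof.
elim: eta l xs y => [|e eta ih] l [|x xs] y //=; first by rewrite addn0.
by move=> _ /andP[/ih /[apply]]; lia.
Qed.

(** Any initial gaps are admissible, because they only push the comparison particles back. This is
    what allows the queues to start from their stationary law although the exclusion process starts
    packed. *)
Lemma behind_nseq K (js : seq nat) (l : int) : l <= 0 -> size js = K ->
  behind l js (nseq K 0%N).
Proof.
elim: K js l => [|K ih] [|j js] l //= l0 [] sjs.
by apply/andP; split; [lia|apply: ih => //; lia].
Qed.

(* The exponential Markov inequality applied separately to the number of arrivals
   and to the total stationary queue length. *)
Lemma tasep_mean_tail (a : R) qs M (r1 r2 theta : R) : (0 < size qs)%N ->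
  all (stable a) qs -> is_prob a -> 0 <= theta ->
  all (fun q => (expR theta - 1) * a < q - a) qs ->
  tasep_mean qs M (fun xs => ((last 0%N xs)%:R <= r1 - r2)%R%:R) (nseq (size qs) 0%N)
  <= expR (theta * r1) * (1 - a + a * expR (- theta)) ^+ M
     + expR (- (theta * r2)) * \prod_(q <- qs) queue_gen a (expR theta) q.
Proof.
move=> qs0 hqs ha t0 hsa.
set g := (fun xs => _ : R).
set u := tasep_mean _ _ _ _; set A := expR (theta * r1) * _.
set k := expR (- (theta * r2)); set G := \prod_(_ <- _) _.
have k0 : 0 <= k by exact: expR_ge0.
pose h1 (l : nat) (eta : seq nat) := expR (theta * r1) * expR (- theta) ^+ l.
pose g2 (eta : seq nat) := k * expR theta ^+ sumn eta.
pose h (l : nat) (eta : seq nat) := h1 l eta + g2 eta.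
have g20 eta : 0 <= g2 eta by rewrite mulr_ge0// exprn_ge0// expR_ge0.
have h10 l eta : 0 <= h1 l eta by rewrite mulr_ge0// ?exprn_ge0// expR_ge0.
have gh (l : nat) eta xs : size xs = size qs -> behind l%:Z eta xs -> g xs <= h l eta.
  move=> sxs hb; have {}hb : (l <= last 0 xs + sumn eta)%N.
    case: xs eta sxs hb => [|x xs] [|e eta] //=; first by case: (qs) qs0.
    by move=> _ /andP[/behind_last /[apply]]; lia.
  rewrite /g; case: (lerP _ (r1 - r2)) => [hr|_]; last by rewrite addr_ge0.
  (* As l <= last + sumn eta, a last particle at most r1 - r2 forces either l <= r1 or sumn eta >
     r2; each case is paid for by one exponential. *)
  have [hl|hl] := lerP l%:R r1.
    rewrite -[leLHS]addr0 lerD// /h1 -expRM_natl -expRD -[leLHS]/(1 : R) -[leLHS]expR0 ler_expR.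
    have -> : theta * r1 + l%:R * - theta = theta * (r1 - l%:R) by ring.
    by rewrite mulr_ge0// subr_ge0.
  rewrite -[leLHS]add0r lerD// /g2 /k -expRM_natl -expRD -[leLHS]/(1 : R) -[leLHS]expR0 ler_expR.
  have -> : - (theta * r2) + (sumn eta)%:R * theta = theta * ((sumn eta)%:R - r2) by ring.
  rewrite mulr_ge0// subr_ge0.
  have : l%:R <= (last 0%N xs)%:R + (sumn eta)%:R :> R by rewrite -natrD ler_nat.
  lra.
(* [u] does not depend on the initial gaps, so averaging over them multiplies it by the truncated
   mass, which tends to 1. *)
have uL L : u * queues_mean a L qs (fun=> 1) <= A * queues_mean a L qs (fun=> 1) + k * G.
  rewrite -queues_meanZ.
  apply: (@le_trans _ _ (queues_mean a L qs (fun js => A * 1 + 1 * network_mean a qs M (fun=> g2) 0 js))).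
    apply: queues_mean_le => // js sjs; rewrite !mulr1 mul1r.
    apply: le_trans (tasep_mean_le_network (l := 0%N) (eta := js) M hqs ha gh _ _) _.
    - by rewrite size_nseq.
    - exact: (behind_nseq (l := 0)).
    by rewrite network_mean_lin lerD2r network_mean_arrivals expr0 mulr1.
  rewrite queues_mean_lin mul1r lerD2l; apply: le_trans (network_mean_stationary hqs ha L M 0 g20) _.
  rewrite /g2 queues_meanZ ler_wpM2l//; apply: queues_mean_gen => //.
  by rewrite -expR0 ler_expR.
have cm := queues_mean_mass hqs.
rewrite -(mulr1 u) -(mulr1 A).
have c1 : (u * queues_mean a L qs (fun=> 1)) @[L --> \oo] --> u * 1.
  by apply: cvgM => //; exact: cvg_cst.
have c2 : (A * queues_mean a L qs (fun=> 1) + k * G) @[L --> \oo] --> A * 1 + k * G.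
  by apply: cvgD; [apply: cvgM => //; exact: cvg_cst|exact: cvg_cst].
by apply: (ler_cvg_to c1 c2); near=> L; exact: uL.
Unshelve. all: by end_near. Qed.

End discrete_exclusion.

(** * Trajectories of the exclusion process *)

Section paths.
Context {R : realType}.

(** Trajectories are described only through left and right neighbourhoods of each time, so global
    facts about them are proved by induction along the real line, via the supremum of the times up
    to which Q holds. *)
Lemma real_induction (Q : R -> Prop) (a b : R) : Q a ->
  (forall t, a <= t -> t < b -> Q t -> \forall s \near t^'+, Q s) ->
  (forall t, a < t -> t <= b -> (forall s, a <= s -> s < t -> Q s) -> Q t) ->
  forall t, a <= t -> t <= b -> Q t.
Proof.
move=> Qa Qr Ql t0 at0 t0b.
pose S := [set t | [/\ a <= t, t <= b & forall s, a <= s -> s <= t -> Q s]].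
have Sa : S a.
  split => //; first exact: le_trans t0b.
  by move=> s h1 h2; have -> : s = a by apply/eqP; rewrite eq_le h1 h2.
have hS : has_sup S by split; [exists a|exists b => x []].
pose m := sup S.
have am : a <= m by apply: ub_le_sup => //; exact: hS.2.
have mb : m <= b by apply: ge_sup; [exists a|move=> x []].
have Qlt s : a <= s -> s < m -> Q s.
  move=> h1 h2; have ms : 0 < m - s by rewrite subr_gt0.
  have [x [_ _ hx] sx] := sup_adherent ms hS.
  by apply: hx => //; move: sx; rewrite -/m opprB addrCA subrr addr0 => /ltW.
have Qm : Q m.
  move: am; rewrite le_eqVlt => /orP[/eqP <- //|am]; exact: Ql.
have [mb'|bm] := ltP m b; last first.
  have [tm|mt] := ltP t0 m; first exact: Qlt.
  suff -> : t0 = m by [].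
  by apply/eqP; rewrite eq_le mt (le_trans t0b).
have [e /= e0 he] := Qr m am mb' Qm.
pose x := Num.min b (m + e / 2).
have mx : m < x by rewrite lt_min mb' ltrDl divr_gt0.
have Sx : S x.
  split; [exact: le_trans (ltW mx)|by rewrite ge_min lexx|move=> s h1 h2].
  have [sm|] := ltP s m; first exact: Qlt.
  rewrite le_eqVlt => /orP[/eqP <- //|ms]; apply: he => //=.
  rewrite distrC gtr0_norm ?subr_gt0//.
  have : s <= m + e / 2 by apply: le_trans h2 _; rewrite ge_min lexx orbT.
  lra.
by have := ub_le_sup hS.2 Sx; rewrite leNgt mx.
Qed.

Lemma near_left_ex (Q : R -> Prop) (a t : R) : a < t ->
  (\forall s \near t^'-, Q s) -> exists s, [/\ a <= s, s < t & Q s].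
Proof.
move=> at_ hQ.
have /filter_ex[s [[h1 h2] h3]] : ((t^'-)%classic : set_system R)
    ((fun s => a < s) `&` (fun s => s < t) `&` Q).
  by do 2![apply: filterI => //]; [exact: nbhs_left_gt|exact: nbhs_left_lt].
by exists s; split => //; exact: ltW.
Qed.

Variables (n : nat -> R -> nat) (x : nat -> R -> int).
Hypotheses (hn : forall k, counting_path (n k)) (hx : exclusion_path n x).

Lemma position_left k (a t : R) : 0 <= a -> a < t -> exists s, [/\ a <= s, s < t,
  x k s <= x k t, x k t <= x k s + 1 &
  x k t = if `[< (n k s < n k t)%N /\ vacant x s (x k s + 1) >]
          then x k s + 1 else x k s].
Proof.
move=> a0 at_; have [_ _ /(_ t (le_lt_trans a0 at_)) h] := hx k.
have [s [h1 h2 h3]] := near_left_ex at_ h.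
by exists s; split => //; rewrite h3; case: asboolP => // _; lia.
Qed.

Lemma position_ge k (s t : R) : 0 <= s -> s <= t -> x k s <= x k t.
Proof.
move=> s0 st; apply: (@real_induction (fun t => x k s <= x k t) s t) => //.
  move=> u su _ h; have [_ /(_ u (le_trans s0 su)) hr _] := hx k.
  by near=> v; have -> : x k v = x k u by near: v.
move=> u su _ h; have [v [h1 h2 h3 _ _]] := position_left k s0 su.
exact: le_trans (h v h1 h2) h3.
Unshelve. all: end_near. Qed.

Lemma positionS_lt k (t : R) : 0 <= t -> x k.+1 t < x k t.
Proof.
move=> t0; apply: (@real_induction (fun t => x k.+1 t < x k t) 0 t) => //.
- by have [-> _ _] := hx k; have [-> _ _] := hx k.+1; lia.
- move=> u u0 _ h; have [_ /(_ u u0) hr _] := hx k; have [_ /(_ u u0) hr' _] := hx k.+1.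
  near=> v; have -> : x k v = x k u by near: v.
  by have -> : x k.+1 v = x k.+1 u by near: v.
- move=> u u0 _ h; have [v [h1 h2 _ _ h3]] := position_left k.+1 (lexx 0) u0.
  have hv := h v h1 h2; have := position_ge k h1 (ltW h2).
  rewrite h3; case: asboolP => [[_ /(_ k)] |_]; lia.
Unshelve. all: end_near. Qed.

Lemma positionD_le j k (t : R) : 0 <= t -> x (k + j)%N t + k%:Z <= x j t.
Proof.
move=> t0; elim: k => [|k ih]; first by rewrite add0n addr0.
by have := positionS_lt (k + j) t0; rewrite addSn; lia.
Qed.

Lemma position_le_rings k (t : R) : 0 <= t -> x k t <= - k%:Z + (n k t)%:Z.
Proof.
move=> t0; apply: (@real_induction (fun t => x k t <= - k%:Z + (n k t)%:Z) 0 t) => //.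
- by have [-> _ _] := hx k; have [-> _ _] := hn k; rewrite addr0.
- move=> u u0 _ h; have [_ /(_ u u0) hr _] := hx k; have [_ _ /(_ u u0) hr'] := hn k.
  near=> v; have -> : x k v = x k u by near: v.
  by have -> : n k v = n k u by near: v.
- move=> u u0 _ h; have [v [h1 h2 _ _ h3]] := position_left k (lexx 0) u0.
  have := h v h1 h2; have [_ /(_ v u h1 (ltW h2)) hm _] := hn k.
  rewrite h3; case: asboolP => [[]|]; lia.
Unshelve. all: end_near. Qed.

(** Particles ahead only move to the right, so a gap in front of a particle persists as long as that
    particle stays put. *)
Lemma vacant_ahead k (s v : R) : 0 <= s -> s <= v -> x k v = x k s ->
  (if k is k'.+1 then x k s + 1 < x k' s else true) -> vacant x v (x k v + 1).
Proof.
move=> s0 sv xE hk i; have v0 := le_trans s0 sv.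
case: (ltngtP i k) => ik.
- case: k xE hk ik => // k xE hk ik.
  have h1 := position_ge k s0 sv.
  have := positionD_le i (k - i) v0; rewrite subnK//.
  by move: (x i v) (x k.+1 v) (x k.+1 s) (x k s) (x k v) xE hk h1 => *; lia.
- have := positionD_le k (i - k) v0; rewrite subnK ?(ltnW ik)//.
  by move: (x i v) (x k v) => *; lia.
- by rewrite ik; move: (x k v) => *; lia.
Qed.

(** If the particle stayed put, the site ahead would remain vacant, so any ring would have moved it;
    by real induction its clock would not have rung. Only the gap at the initial time matters, as in
    the discrete dynamics. *)
Lemma position_jump k (s t : R) : 0 <= s -> s < t -> (n k s < n k t)%N ->
  (if k is k'.+1 then x k s + 1 < x k' s else true) -> x k s + 1 <= x k t.
Proof.
move=> s0 st ns hk; rewrite leNgt; apply/negP => xt.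
have xE u : s <= u -> u <= t -> x k u = x k s.
  move=> su ut; have h1 := position_ge k s0 su.
  have h2 := position_ge k (le_trans s0 su) ut.
  by move: (x k u) (x k s) (x k t) xt h1 h2 => *; lia.
suff : n k t = n k s by move=> nE; rewrite nE ltnn in ns.
apply: (@real_induction (fun t => n k t = n k s) s t) => //; last exact: ltW.
- move=> u su _ <-; have [_ _ h] := hn k; exact: h (le_trans s0 su).
- move=> u su ut h; have [v [h1 h2 _ _ h3]] := position_left k s0 su.
  have v0 := le_trans s0 h1.
  have vt : v <= t := le_trans (ltW h2) ut.
  have [_ /(_ v u v0 (ltW h2)) hm _] := hn k; have hv := h v h1 h2.
  have vac := vacant_ahead s0 h1 (xE v h1 vt) hk.
  move: h3; rewrite (xE u (ltW su) ut); case: asboolP => [_|hv' _].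
    by rewrite (xE v h1 vt) => /eqP; rewrite -subr_eq0 opprD addrA subrr.
  apply/eqP; rewrite -hv eq_sym eqn_leq hm /= leqNgt; apply/negP => nlt.
  by apply: hv'.
Qed.

End paths.

(** * Clocks given the rates *)

Section clock_patterns.
Context {R : realType} {d : measure_display} {T : measurableType d}.
Variable P : probability T R.
Variables (p : nat -> {RV P >-> R}) (N : nat -> R -> {RV P >-> nat}).

Lemma rate_eventsS : rate_events p `<=` measurable.
Proof.
apply: smallest_sub; first exact: sigma_algebra_measurable.
by move=> _ [k _ [A mA <-]]; rewrite setTI; exact: measurable_funPTI.
Qed.

Lemma rate_events_preimage k (A : set R) : measurable A -> rate_events p (p k @^-1` A).
Proof.
move=> mA; apply: sub_sigma_algebra; exists k => //; exists A => //.
by rewrite setTI.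
Qed.

Lemma rate_events_forall K (A : set R) : measurable A ->
  rate_events p [set w | forall k, (k < K)%N -> A (p k w)].
Proof.
move=> mA; have [s0 sC sU] := smallest_sigma_algebra [set: T]
  (\bigcup_k preimage_set_system setT (p k) measurable).
rewrite (_ : [set w | _] = [set: T] `\`
    \bigcup_k (if (k < K)%N then p k @^-1` (~` A) else set0)).
  apply: sC; apply: sU => k; case: ifP => // _.
  by apply: rate_events_preimage; exact: measurableC.
apply/seteqP; split => w /=.
  by move=> h; split => // -[k _]; case: ifP => // kK; apply; exact: h.
move=> [_ h] k kK; apply: contrapT => nA; apply: h; exists k => //.
by rewrite kK.
Qed.

(** The increment [v] is explicit because a difference of natural numbers would be truncated, and
    counts are monotone only almost surely. *)
Definition increment_in (k : nat) (s s' : R) (E : pred nat) : set T :=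
  [set w | exists2 v, E v & N k s' w = (N k s w + v)%N].

Lemma measurable_increment_in k s s' E : measurable (increment_in k s s' E).
Proof.
rewrite (_ : increment_in _ _ _ _ = \bigcup_u \bigcup_(v in [set v | E v])
    ((N k s @^-1` [set u]) `&` (N k s' @^-1` [set (u + v)%N]))); last first.
  apply/seteqP; split => w /=.
    by move=> [v Ev nE]; exists (N k s w) => //; exists v.
  by move=> [u _ [v Ev [/= <- nE]]]; exists v.
apply: bigcup_measurable => u _; apply: bigcup_measurable => v _.
by apply: measurableI; exact: measurable_funPTI.
Qed.

Hypothesis hN : poisson_clocks_given_rates p N.
Variables (K M : nat) (s : nat -> R) (B : set T).
Hypotheses (s0 : 0 <= s 0%N) (ss : forall i, s i < s i.+1) (hB : rate_events p B).
Variables (E : nat * nat -> pred nat) (m : nat * nat -> T -> R).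
Hypotheses (mm : forall e, measurable_fun setT (m e)) (m0 : forall e w, 0 <= m e w).
Hypothesis hm : forall k i w, (k < K)%N -> (i < M)%N -> B w ->
  (\sum_(0 <= v <oo | E (k, i) v) (poisson_pmf (p k w * (s i.+1 - s i)) v)%:E
   <= (m (k, i) w)%:E)%E.

(** Cells in [l] have their increment in [E]; the others carry an exact value [j], the form in which
    the law of the clocks is given. *)
Let pattern (l : seq (nat * nat)) (j : nat * nat -> nat) : set T :=
  [set w | forall k i, (k < K)%N -> (i < M)%N -> increment_in k (s i) (s i.+1)
    (if (k, i) \in l then E (k, i) else pred1 (j (k, i))) w].

Let weight (l : seq (nat * nat)) (j : nat * nat -> nat) (e : nat * nat) (w : T) : R :=
  if e \in l then m e w else poisson_pmf (p e.1 w * (s e.2.+1 - s e.2)) (j e).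

Let measurable_pattern l j : measurable (pattern l j).
Proof.
rewrite (_ : pattern l j = \bigcap_(k in `I_K) \bigcap_(i in `I_M)
  increment_in k (s i) (s i.+1)
    (if (k, i) \in l then E (k, i) else pred1 (j (k, i)))); last first.
  by apply/seteqP; split => w /= h k hk i hi; exact: h.
apply: bigcap_measurableType => k _; apply: bigcap_measurableType => i _.
exact: measurable_increment_in.
Qed.

Let weight_ge0 l j e w : 0 <= weight l j e w.
Proof. by rewrite /weight; case: ifP => _ //; exact: poisson_pmf_ge0. Qed.

Let measurable_weight l j e : measurable_fun setT (weight l j e).
Proof.
rewrite /weight; case: (e \in l); first exact: mm.
apply: (@measurableT_comp _ _ _ _ _ _ (@poisson_pmf R ^~ (j e))).
  exact: measurable_poisson_pmf.
by apply: measurable_funM => //; exact: measurable_cst.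
Qed.

Let total l j w := \prod_(e : 'I_K * 'I_M) weight l j (val e.1, val e.2) w.

Let measurable_total l j : measurable_fun setT (fun w => (total l j w)%:E).
Proof.
apply/measurable_EFinP; rewrite /total.
by apply: measurable_prod => e _; exact: measurable_weight.
Qed.

Let mB : measurable B. Proof. exact: rate_eventsS. Qed.

(** Cells are relaxed one at a time from an exact value to [E]: a union bound over the value of the
    cell, an exchange of sum and integral, and [hm] for the resulting Poisson sum. *)
Let pattern_le_aux l j : uniq l -> all (fun e => (e.1 < K)%N && (e.2 < M)%N) l ->
  (P (B `&` pattern l j) <= \int[P]_(w in B) (total l j w)%:E)%E.
Proof.
elim: l j => [|e l ih] j /=.
  move=> _ _; rewrite le_eqVlt; apply/orP; left; apply/eqP.
  have := hN.2 K M s (fun k i => j (k, i)) B s0 ss hB.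
  have <- : pattern [::] j = [set w | forall k i, (k < K)%N -> (i < M)%N ->
      N k (s i.+1) w = (N k (s i) w + j (k, i))%N].
    apply/seteqP; split => w /= h k i hk hi.
      by have [v /= /eqP -> ->] := h k i hk hi.
    by exists (j (k, i)) => //=; exact: h.
  move=> ->; apply: eq_integral => w _; congr (_%:E).
  by rewrite /total (pair_bigA _ (fun (k : 'I_K) (i : 'I_M) =>
    poisson_pmf (p k w * (s i.+1 - s i)) (j (val k, val i)))).
move=> /andP[el ul] /andP[/andP[eK eM] al].
pose upd v e' := if e' == e then v else j e'.
pose F v := if E e v then B `&` pattern l (upd v) else set0.
have mF v : measurable (F v) by rewrite /F; case: ifP => _ //; exact: measurableI.
apply: (@le_trans _ _ (\sum_(0 <= v <oo) P (F v))%E).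
  apply: measure_sigma_subadditive => //; first exact: measurableI.
  move=> w [Bw hw].
  have := hw e.1 e.2 eK eM; rewrite -surjective_pairing mem_head => -[v Ev nE].
  exists v => //; rewrite /F Ev; split => // k i hk hi.
  have := hw k i hk hi; rewrite inE /upd; case: eqVneq => [keq _|_ //].
  by rewrite keq (negbTE el); exists v => /=; rewrite ?eqxx//; move: nE; rewrite -keq.
apply: (@le_trans _ _ (\sum_(0 <= v <oo) \int[P]_(w in B) (if E e v then total l (upd v) w else 0)%:E)%E).
  apply: lee_nneseries => // v _; rewrite /F.
  by case: ifP => _; [exact: ih|rewrite measure0; apply: integral_ge0].
rewrite -integral_nneseries//; last 2 first.
- by move=> v; case: (E e v); [exact: measurable_funTS|exact: measurable_cst].
- by move=> v w _; rewrite lee_fin; case: ifP => // _; rewrite /total prodr_ge0.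
apply: ge0_le_integral => //.
- move=> w _; apply: nneseries_ge0 => v _ _.
  by rewrite lee_fin; case: ifP => // _; rewrite /total prodr_ge0.
- apply: ge0_emeasurable_sum => [v w _ _|v _].
    by rewrite lee_fin; case: ifP => // _; rewrite /total prodr_ge0.
  by case: (E e v); [exact: measurable_funTS|exact: measurable_cst].
- exact: measurable_funTS.
move=> w Bw.
pose e0 : 'I_K * 'I_M := (Ordinal eK, Ordinal eM).
have e0E : (val e0.1, val e0.2) = e by rewrite [RHS]surjective_pairing.
pose C := \prod_(e' : 'I_K * 'I_M | e' != e0) weight (e :: l) j (val e'.1, val e'.2) w.
have C0 : 0 <= C by rewrite /C prodr_ge0.
have -> : total (e :: l) j w = m e w * C.
  by rewrite /total (bigD1 e0)//= [X in X * _]/weight e0E mem_head.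
have tE v : total l (upd v) w = poisson_pmf (p e.1 w * (s e.2.+1 - s e.2)) v * C.
  rewrite /total (bigD1 e0)//= [X in X * _]/weight e0E (negbTE el) /upd eqxx.
  congr (_ * _); apply: eq_bigr => e' ne; rewrite /weight inE.
  suff /negbTE -> : (val e'.1, val e'.2) != e by [].
  apply: contra ne => /eqP he; rewrite -e0E in he; apply/eqP.
  by case: e' he => [a b] [ha hb]; congr (_, _); exact: val_inj.
under eq_eseriesr => v _.
  rewrite (_ : _%:E = (C%:E * (if E e v then
    (poisson_pmf (p e.1 w * (s e.2.+1 - s e.2)) v)%:E else 0))%E); last first.
    by case: ifP => _; rewrite ?mule0// tE mulrC EFinM.
  over.
rewrite nneseriesZl; last by move=> v _; case: ifP => // _; rewrite lee_fin poisson_pmf_ge0.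
rewrite -eseries_mkcond [m e w * C]mulrC EFinM; apply: lee_wpmul2l => //.
by have := hm eK eM Bw; rewrite -surjective_pairing.
Qed.

Lemma clock_pattern_le :
  (P (B `&` [set w | forall k i, (k < K)%N -> (i < M)%N ->
        increment_in k (s i) (s i.+1) (E (k, i)) w])
   <= \int[P]_(w in B) (\prod_(k < K) \prod_(i < M) m (val k, val i) w)%:E)%E.
Proof.
pose l := [seq (k, i) | k <- iota 0 K, i <- iota 0 M].
have lP k i : (k < K)%N -> (i < M)%N -> (k, i) \in l.
  by move=> hk hi; apply/allpairsP; exists (k, i); rewrite !mem_iota.
have ul : uniq l.
  by apply: allpairs_uniq; rewrite ?iota_uniq// => -[? ?] [? ?] _ _.
have al : all (fun e => (e.1 < K)%N && (e.2 < M)%N) l.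
  by apply/allP => _ /allpairsP[[k i] [/= + + ->]]; rewrite !mem_iota /= !add0n => -> ->.
have := pattern_le_aux (fun=> 0%N) ul al.
rewrite (_ : pattern _ _ = [set w | forall k i, (k < K)%N -> (i < M)%N ->
        increment_in k (s i) (s i.+1) (E (k, i)) w]); last first.
  by apply/seteqP; split => w /= h k i hk hi; have := h k i hk hi; rewrite lP.
move=> /le_trans; apply; rewrite le_eqVlt; apply/orP; left; apply/eqP.
apply: eq_integral => w _; congr (_%:E).
rewrite /total (pair_bigA _ (fun (k : 'I_K) (i : 'I_M) => m (val k, val i) w)) /=.
by apply: eq_bigr => e _; rewrite /weight lP.
Qed.

End clock_patterns.

(** * Independent rates *)

Section independence.
Context {R : realType} {d : measure_display} {T : measurableType d}.
Variable P : probability T R.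
Variables (F : cumulativeBounded (0 : R) (1 : R)) (p : nat -> {RV P >-> R}).
Hypothesis hp : iid_with_cdf F p.

Lemma rate_cdf_le k (x : R) : P (p k @^-1` `]-oo, x]) = (F x)%:E.
Proof. exact: hp.1. Qed.

Lemma rate_itv_oc k (x y : R) : x <= y -> P (p k @^-1` `]x, y]) = (F y - F x)%:E.
Proof.
move=> xy; rewrite EFinB -!(rate_cdf_le k).
rewrite (_ : `]x, y]%classic = `]-oo, y] `\` `]-oo, x]); last first.
  by rewrite -[RHS]setCK setCD setCitvl setUC -[LHS]setCK setCitv.
rewrite [p k @^-1` _](_ : _ = p k @^-1` `]-oo, y] `\` p k @^-1` `]-oo, x])//.
rewrite measureD; [|exact: measurable_funPTI..|]; last first.
  by rewrite ltey_eq fin_num_measure//; exact: measurable_funPTI.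
by rewrite setIidr//; apply: preimage_subset; exact: subset_itvl.
Qed.

Lemma rate_law k (A : set R) : measurable A ->
  P (p k @^-1` A) = lebesgue_stieltjes_measure F A.
Proof.
have mX : measurable_fun setT (p k : T -> measurableTypeR R).
  by move=> _ Y mY; rewrite setTI; exact: (measurable_funPTI (p k) (Y := Y)).
pose X : {mfun T >-> measurableTypeR R} :=
  HB.pack (p k : T -> measurableTypeR R) (isMeasurableFun.Build _ _ _ _ _ mX).
move=> mA; rewrite -[LHS]/(distribution P X A); symmetry.
apply: (@lebesgue_stieltjes_measure_unique R F (distribution P X)) => //.
move=> I [[a b]]/= _ <-.
rewrite /lebesgue_stieltjes_measure /measure_extension/=.
rewrite measurable_mu_extE/=; last exact: is_ocitv.
have [ab | ba] := leP a b; last first.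
  by rewrite set_itv_ge ?wlength0 ?measure0// bnd_simp -leNgt ltW.
by rewrite wlength_itv_bnd// /distribution /pushforward rate_itv_oc.
Qed.

Lemma prod_indicator (I : finType) (b : I -> bool) :
  \prod_i (b i)%:R = [forall i, b i]%:R :> R.
Proof.
case: forallP => [h|/existsNP[i /negP/negbTE hi]].
  by rewrite big1// => i _; rewrite h.
by rewrite (bigD1 i)//= hi mul0r.
Qed.

Lemma independent_preimages (K L : nat) (A : 'I_L -> set R) (f : 'I_K -> 'I_L) :
  (forall v, measurable (A v)) ->
  P [set x | forall k : 'I_K, A (f k) (p k x)] =
  (\prod_(k < K) fine (P (p 0%N @^-1` A (f k))))%:E.
Proof.
move=> mA.
(* Independence is stated for families indexed by all natural numbers; indices from K on receive the
   full set. *)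
pose A' k := if insub k is Some i then A (f i) else setT : set R.
have mA' k : measurable (A' k) by rewrite /A'; case: insubP.
pose J := seq_fset tt (iota 0 K).
have := hp.2 J A' mA'.
rewrite (_ : \bigcap_(k in _) _ = [set x | forall k : 'I_K, A (f k) (p k x)]); last first.
  apply/seteqP; split => x /=.
    move=> h k; have /= := h (val k); rewrite /J seq_fsetE mem_iota /= ltn_ord => /(_ isT).
    by rewrite /A' valK.
  move=> h k /=; rewrite /J seq_fsetE mem_iota /= add0n => kK.
  by rewrite /A' insubT; exact: h.
move=> ->; rewrite (perm_big _ (seq_fset_perm tt _)) undup_id ?iota_uniq//=.
rewrite -[X in iota 0 X](subn0 K) -/(index_iota 0 K) big_mkord -prodEFin.
apply: eq_bigr => k _; rewrite /A' valK rate_law// -(rate_law 0)// fineK// fin_num_measure//.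
exact: measurable_funPTI.
Qed.

Lemma measurable_indic_rate k (A : set R) : measurable A ->
  measurable_fun setT (fun x => \1_A (p k x) : R).
Proof. by move=> mA; exact: (measurable_indic (measurable_funPTI (p k) mA)). Qed.

(** Expanding the product of sums yields one term per map from particles to levels. Each is the
    probability of a rectangle, which factorizes, and the sum then refolds into a power. *)
Lemma integral_prod_simple (K L : nat) (A : 'I_L -> set R) (w : 'I_L -> R) :
  (forall v, measurable (A v)) -> (forall v, 0 <= w v) ->
  (\int[P]_x (\prod_(k < K) \sum_(v < L) w v * \1_(A v) (p k x))%:E =
   ((\sum_(v < L) w v * fine (P (p 0%N @^-1` A v))) ^+ K)%:E)%E.
Proof.
move=> mA w0.
pose D (f : {ffun 'I_K -> 'I_L}) : set T := [set x | forall k : 'I_K, A (f k) (p k x)].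
have mD f : measurable (D f).
  rewrite (_ : D f = \bigcap_(k : 'I_K) (p k @^-1` A (f k))); last first.
    by apply/seteqP; split => x /= h k => [_|]; exact: h.
  by apply: fin_bigcap_measurable => // k _; exact: measurable_funPTI.
under eq_integral => x _.
  rewrite bigA_distr_bigA /=.
  rewrite (eq_bigr (fun f : {ffun 'I_K -> 'I_L} => (\prod_(k < K) w (f k)) * \1_(D f) x)); last first.
    move=> f _; rewrite big_split /=; congr (_ * _).
    under eq_bigr do rewrite indicE.
    rewrite prod_indicator indicE; congr (_%:R); congr nat_of_bool.
    apply/forallP/idP => [h|]; first by rewrite inE => k; have := h k; rewrite inE.
    by rewrite inE => h k; rewrite inE; exact: h.
  rewrite -sumEFin.
  over.
rewrite ge0_integral_sum//; last 2 first.
- by move=> f; apply/measurable_EFinP; apply: measurable_funM => //; exact: measurable_cst.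
- by move=> f x _; rewrite lee_fin mulr_ge0// prodr_ge0.
rewrite -[in RHS](card_ord K) -prodr_const bigA_distr_bigA -sumEFin /=.
apply: eq_bigr => f _.
under eq_integral do rewrite EFinM.
rewrite ge0_integralZl_EFin//; last 2 first.
- by apply/measurable_EFinP; exact: measurable_indic.
- by rewrite prodr_ge0.
by rewrite integral_indic// setIT big_split/= EFinM; congr (_ * _)%E; exact: independent_preimages.
Qed.

(** [h] is bounded above by a step function within [m.+1%:R^-1] of it, to which
    [integral_prod_simple] applies, and m tends to infinity. Boundedness of [h] leaves finitely many
    levels. *)
Lemma integral_prod_le (K : nat) (h : R -> R) (C c : R) :
  measurable_fun setT h -> (forall x, 0 <= h x) -> (forall x, h x <= C) ->
  (\int[P]_w (h (p 0%N w))%:E <= c%:E)%E -> 0 <= c ->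
  (\int[P]_w (\prod_(k < K) h (p k w))%:E <= (c ^+ K)%:E)%E.
Proof.
move=> mh h0 hC hc c0.
have key (m : nat) : (\int[P]_w (\prod_(k < K) h (p k w))%:E <=
    ((c + m.+1%:R^-1) ^+ K)%:E)%E.
  pose n1 : R := m.+1%:R.
  have n10 : 0 < n1 by rewrite /n1 ltr0n.
  pose V x := Num.truncn (n1 * h x).
  have hV x : (V x)%:R <= n1 * h x < (V x).+1%:R.
    by apply: truncn_itv; rewrite mulr_ge0// ltW.
  pose L := (Num.truncn (n1 * C)).+1.
  have VL x : (V x < L)%N.
    rewrite /V truncn_lt_nat ?mulr_ge0 ?(ltW n10)//; apply: (@le_lt_trans _ _ (n1 * C)).
      by rewrite ler_pM2l.
    exact: truncnS_gt.
  pose A (v : 'I_L) := [set x | V x = v].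
  pose w (v : 'I_L) : R := v.+1%:R / n1.
  have w0 v : 0 <= w v by rewrite divr_ge0// ltW.
  have mA v : measurable (A v).
    rewrite (_ : A v = setT `&` ((fun x => n1 * h x) @^-1` `[v%:R, v.+1%:R[)); last first.
      rewrite setTI; apply/seteqP; split => x /=; rewrite in_itv /=.
        by move=> <-; exact: hV.
      by move=> hx; apply/eqP; rewrite /V truncn_eq// mulr_ge0// ltW.
    by apply: measurable_funM => //; exact: measurable_cst.
  have sE x : \sum_(v < L) w v * \1_(A v) x = (V x).+1%:R / n1.
    rewrite (bigD1 (Ordinal (VL x)))//= indicE mem_set// mulr1 big1 ?addr0// => v ne.
    rewrite indicE memNset ?mulr0// => /= e; move: ne; rewrite /A /= in e *.
    by rewrite -val_eqE /= e eqxx.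
  have hs x : h x <= (V x).+1%:R / n1.
    by rewrite ler_pdivlMr// mulrC; have /andP[_ /ltW] := hV x.
  have sh x : (V x).+1%:R / n1 <= h x + n1^-1.
    rewrite ler_pdivrMr// mulrDl mulVf ?gt_eqF// -natr1 lerD2r mulrC.
    by have /andP[] := hV x.
  apply: (@le_trans _ _ (\int[P]_x (\prod_(k < K) \sum_(v < L) w v * \1_(A v) (p k x))%:E)%E).
    apply: ge0_le_integral => //.
    - by move=> x _; rewrite lee_fin prodr_ge0.
    - apply/measurable_EFinP; apply: measurable_prod => k _.
      exact: measurableT_comp.
    - apply/measurable_EFinP; apply: measurable_prod => k _.
      apply: measurable_sum => v; apply: measurable_funM; first exact: measurable_cst.
      exact: measurable_indic_rate.
    - move=> x _; rewrite lee_fin; apply: ler_prod => k _.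
      by rewrite h0 sE hs.
  rewrite integral_prod_simple// lee_fin lerXn2r ?nnegrE//.
  - by rewrite sumr_ge0// => v _; rewrite mulr_ge0// fine_ge0.
  - by rewrite addr_ge0// ltW ?invr_gt0.
  rewrite -lee_fin -sumEFin.
  rewrite [leLHS](_ : _ = \int[P]_x ((V (p 0%N x)).+1%:R / n1)%:E)%E; last first.
    under [RHS]eq_integral do rewrite -sE -sumEFin.
    rewrite ge0_integral_sum//; last 2 first.
    - move=> v; apply/measurable_EFinP; apply: measurable_funM; first exact: measurable_cst.
      exact: measurable_indic_rate.
    - by move=> v x _; rewrite lee_fin mulr_ge0.
    apply: eq_bigr => v _; under eq_integral do rewrite EFinM.
    rewrite ge0_integralZl_EFin//; last first.
      apply/measurable_EFinP.
      exact: measurable_indic_rate.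
    have mpA : measurable (p 0%N @^-1` A v) by exact: measurable_funPTI.
    rewrite EFinM fineK ?fin_num_measure//; congr (_ * _)%E.
    by rewrite -[in LHS](setIT (p 0%N @^-1` A v)) -integral_indic.
  apply: (@le_trans _ _ (\int[P]_x ((h (p 0%N x))%:E + (n1^-1)%:E))%E).
    apply: ge0_le_integral => //.
    - by move=> x _; rewrite lee_fin divr_ge0// ltW.
    - apply/measurable_EFinP; under eq_fun do rewrite -sE.
      apply: measurable_sum => v; apply: measurable_funM; first exact: measurable_cst.
      exact: measurable_indic_rate.
    - apply: emeasurable_funD; last exact: measurable_cst.
      by apply/measurable_EFinP; exact: measurableT_comp.
    - by move=> x _; rewrite -EFinD lee_fin sh.
  rewrite ge0_integralD//; last 3 first.
  - by move=> x _; rewrite lee_fin.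
  - by apply/measurable_EFinP; exact: measurableT_comp.
  - by move=> x _; rewrite lee_fin ltW ?invr_gt0.
  rewrite integral_cst// [X in (_ * X)%E](_ : _ = 1%E); last exact: probability_setT.
  by rewrite mule1 EFinD leeD2r.
have cvgc : ((c + m.+1%:R^-1) ^+ K) @[m --> \oo] --> c ^+ K.
  have h1 : (c + m.+1%:R^-1) @[m --> \oo] --> c + 0.
    by apply: cvgD; [exact: cvg_cst|exact: cvg_harmonic].
  rewrite addr0 in h1.
  by apply: (@cvg_comp _ _ _ _ (fun x : R => x ^+ K) _ _ _ h1); exact: exprn_continuous.
have [r rE] : exists r, (\int[P]_w (\prod_(k < K) h (p k w))%:E = r%:E)%E.
  have := key 0%N; have : (0 <= \int[P]_w (\prod_(k < K) h (p k w))%:E)%E.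
    by apply: integral_ge0 => x _; rewrite lee_fin prodr_ge0.
  by case: (\int[P]_w _)%E => [r| |] // _ _; exists r.
rewrite rE lee_fin; apply: (cvgr_to_ge cvgc); near=> m.
by have := key m; rewrite rE lee_fin.
Unshelve. all: by end_near. Qed.

End independence.

(** * Bounds at a fixed time *)

Section poisson_sums.
Context {R : realType}.

Lemma poisson_pmf_sum (rate : R) : 0 < rate ->
  (\sum_(0 <= v <oo) (poisson_pmf rate v)%:E = 1)%E.
Proof.
move=> r0; have : (poisson_prob rate 0 setT = 1)%E := probability_setT (poisson_prob rate 0).
rewrite /poisson_prob r0 -nneseries_esumT//.
by move=> *; rewrite lee_fin poisson_pmf_ge0.
Qed.

Lemma poisson_pmf_sum_neq0 (rate : R) : 0 < rate ->
  (\sum_(0 <= v <oo | v != 0%N) (poisson_pmf rate v)%:E <= (1 - expR (- rate))%:E)%E.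
Proof.
move=> r0; have := poisson_pmf_sum r0.
rewrite (@nneseriesD1 _ _ 0%N)//; last by move=> v _; rewrite lee_fin poisson_pmf_ge0.
have -> : poisson_pmf rate 0 = expR (- rate).
  by rewrite /poisson_pmf r0 expr0 fact0 invr1 !mul1r.
by move=> hs; rewrite EFinB leeBrDl// hs.
Qed.

(** Exponential tilting turns a Poisson law into another one, so the Chernoff bound below follows
    from a total mass equal to one. *)
Lemma poisson_pmf_tilt (rate theta : R) v : 0 < rate ->
  poisson_pmf rate v * expR (theta * v%:R) =
  expR (rate * (expR theta - 1)) * poisson_pmf (rate * expR theta) v.
Proof.
move=> r0; have h : 0 < rate * expR theta by rewrite mulr_gt0// expR_gt0.
rewrite /poisson_pmf r0 h mulrC [theta * _]mulrC expRM_natl exprMn.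
rewrite mulrBr mulr1 expRD.
have e : expR (rate * expR theta) * expR (- (rate * expR theta)) = 1.
  by rewrite expRN divff// gt_eqF// expR_gt0.
transitivity ((expR (rate * expR theta) * expR (- (rate * expR theta))) *
   (expR theta ^+ v * (rate ^+ v / v`!%:R * expR (- rate)))); last by ring.
by rewrite e mul1r.
Qed.

Lemma poisson_pmf_tail (rate theta r : R) : 0 < rate -> 0 <= theta ->
  (\sum_(0 <= v <oo | (r < v%:R)%R) (poisson_pmf rate v)%:E <=
    (expR (rate * (expR theta - 1) - theta * r))%:E)%E.
Proof.
move=> r0 t0; have h : 0 < rate * expR theta by rewrite mulr_gt0// expR_gt0.
pose C := expR (rate * (expR theta - 1) - theta * r).
apply: (@le_trans _ _ (\sum_(0 <= v <oo) (C%:E * (poisson_pmf (rate * expR theta) v)%:E))%E).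
  rewrite eseries_mkcond; apply: lee_nneseries => v _.
    by case: ifP => // _; rewrite lee_fin poisson_pmf_ge0.
  case: ifP => [rv|_]; last by rewrite mule_ge0// lee_fin ?expR_ge0 ?poisson_pmf_ge0.
  rewrite -EFinM lee_fin /C expRD mulrAC -poisson_pmf_tilt// -mulrA -expRD.
  rewrite ler_peMr ?poisson_pmf_ge0// -[leLHS]expR0 ler_expR -mulrBr mulr_ge0//.
  by rewrite subr_ge0 ltW.
rewrite nneseriesZl; last by move=> v _; rewrite lee_fin poisson_pmf_ge0.
by rewrite poisson_pmf_sum// mule1.
Qed.

End poisson_sums.

(** * Many clocks ringing often in one time interval *)

Section one_interval.
Context {R : realType} {d : measure_display} {T : measurableType d}.
Variable P : probability T R.

Lemma le_measure_ae (A B : set T) : measurable A -> measurable B ->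
  {ae P, forall w, A w -> B w} -> (P A <= P B)%E.
Proof.
move=> mA mB [Z [mZ PZ hZ]]; apply: (@le_trans _ _ (P (B `|` Z))).
  apply: le_measure; rewrite ?inE//; first exact: measurableU.
  move=> w Aw; have [Bw|nBw] := pselect (B w); first by left.
  by right; apply: hZ => /= /(_ Aw).
apply: le_trans (measureU2 _ _ _) _ => //; rewrite -[leRHS]adde0; apply: leeD => //.
by move/eqP: PZ; rewrite eq_le => /andP[].
Qed.

Variables (F : cumulativeBounded (0 : R) (1 : R)) (p : nat -> {RV P >-> R}).
Variable N : nat -> R -> {RV P >-> nat}.
Hypotheses (hp : iid_with_cdf F p) (hN : poisson_clocks_given_rates p N).

Lemma rates_gt (c : R) : F c = 0 -> {ae P, forall w, forall k, c < p k w}.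
Proof.
move=> Fc; apply/ae_foralln => k; exists (p k @^-1` `]-oo, c]); split.
- exact: measurable_funPTI.
- by have := rate_cdf_le hp k c; rewrite Fc.
- by move=> w /= /negP; rewrite -leNgt in_itv.
Qed.

(* Rates at most x0 make r rings before t unlikely, by the Chernoff bound. *)
Lemma many_rings_le (A : set T) (c x0 t r theta eps : R) (K : nat) :
  measurable A ->
  {ae P, forall w, A w -> forall k, (k < K)%N -> r < (N k t w)%:R} ->
  0 <= c -> F c = 0 -> 0 < t -> 0 <= theta -> 0 <= eps -> eps <= 1 ->
  expR (x0 * t * (expR theta - 1) - theta * r) <= eps ->
  (P A <= ((1 - (1 - eps) * F x0) ^+ K)%:E)%E.
Proof.
move=> mA hA c0 Fc t0 th0 e0 e1 hx.
pose h (x : R) : R := eps * \1_`]-oo, x0] x + \1_(~` `]-oo, x0]) x.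
have hE (x : R) : h x = if x <= x0 then eps else 1.
  rewrite /h !indicE in_setC mem_setE in_itv /=; case: ifP => _ /=;
  by rewrite ?mulr1 ?mulr0 ?addr0 ?add0r.
have h0 x : 0 <= h x by rewrite hE; case: ifP.
have h1 x : h x <= 1 by rewrite hE; case: ifP.
have mh : measurable_fun setT h.
  apply: measurable_funD; last by apply: measurable_indic; exact: measurableC.
  by apply: measurable_funM; [exact: measurable_cst|exact: measurable_indic].
pose B : set T := [set w | forall k, (k < K)%N -> `]c, +oo[%classic (p k w)].
have hB : rate_events p B by exact: rate_events_forall.
(* Only the interval from 0 to t is used; the later points complete the strictly increasing sequence
   required by the law of the clocks. *)
pose s (i : nat) : R := i%:R * t.
have s0 : 0 <= s 0%N by rewrite /s mul0r.
have ss i : s i < s i.+1 by rewrite /s ltr_pM2r// ltr_nat.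
pose E (e : nat * nat) : pred nat := fun v => r < v%:R.
pose m (e : nat * nat) (w : T) := h (p e.1 w).
have mm e : measurable_fun setT (m e) by exact: measurableT_comp.
have m0 e w : 0 <= m e w by exact: h0.
have hm k i w : (k < K)%N -> (i < 1)%N -> B w ->
    (\sum_(0 <= v <oo | E (k, i) v) (poisson_pmf (p k w * (s i.+1 - s i)) v)%:E
     <= (m (k, i) w)%:E)%E.
  move=> kK _ /(_ k kK) /=; rewrite in_itv /= andbT => cp.
  have -> : s i.+1 - s i = t by rewrite /s -mulrBl -natr1 addrAC subrr add0r mul1r.
  have pt : 0 < p k w * t by rewrite mulr_gt0// (le_lt_trans c0).
  rewrite /m /= hE; case: ifP => px; last first.
    rewrite -(poisson_pmf_sum pt) eseries_mkcond; apply: lee_nneseries => v _.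
      by case: ifP => // _; rewrite lee_fin poisson_pmf_ge0.
    by case: ifP => // _; rewrite lee_fin poisson_pmf_ge0.
  apply: le_trans (poisson_pmf_tail _ pt th0) _; rewrite lee_fin.
  apply: le_trans hx; rewrite ler_expR lerD2r ler_wpM2r//.
    by rewrite subr_ge0 -expR0 ler_expR.
  by rewrite ler_wpM2r// ltW.
have := clock_pattern_le hN s0 ss hB mm m0 hm.
set B' := (X in P (B `&` X)) => hB'.
have mB' : measurable B'.
  rewrite (_ : B' = \bigcap_(k in `I_K) \bigcap_(i in `I_1)
    increment_in N k (s i) (s i.+1) (E (k, i))); last first.
    by apply/seteqP; split => w /= h' k hk i hi; exact: h'.
  apply: bigcap_measurableType => k _; apply: bigcap_measurableType => i _.
  exact: measurable_increment_in.
apply: (@le_trans _ _ (P (B `&` B'))).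
  apply: le_measure_ae => //; first by apply: measurableI => //; exact: (rate_eventsS hB).
  have := rates_gt Fc; have := hN.1; apply: filterS3 hA => w hA hN1 hc Aw; split.
    by move=> k _ /=; rewrite in_itv /= hc.
  move=> k [|//] kK _; exists (N k t w); first exact: hA.
  by have [N0 _ _] := hN1 k; rewrite /s mul0r mul1r N0.
apply: le_trans hB' _.
apply: (@le_trans _ _ (\int[P]_w (\prod_(k < K) h (p k w))%:E)%E).
  rewrite [leLHS](_ : _ = \int[P]_(w in B) (\prod_(k < K) h (p k w))%:E)%E; last first.
    by apply: eq_integral => w _; congr (_%:E); apply: eq_bigr => k _; rewrite big_ord1.
  apply: ge0_subset_integral => //.
  - exact: (rate_eventsS hB).
  - apply/measurable_EFinP; apply: measurable_prod => k _; exact: (measurableT_comp mh).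
  - by move=> w _; rewrite lee_fin prodr_ge0.
have mpx : measurable (p 0%N @^-1` `]-oo, x0]) by exact: measurable_funPTI.
have F1 : F x0 <= 1.
  by rewrite -lee_fin -(rate_cdf_le hp 0); apply: probability_le1.
have F0 : 0 <= F x0 by rewrite -lee_fin -(rate_cdf_le hp 0).
apply: (@integral_prod_le _ _ _ _ _ _ hp K h 1 _) => //; last by nra.
rewrite /h; under eq_integral do rewrite EFinD EFinM.
have mi : measurable_fun setT (fun w => (\1_`]-oo, x0] (p 0%N w) : R)%:E).
  by apply/measurable_EFinP; exact: measurable_indic_rate.
have mi' : measurable_fun setT (fun w => (\1_(~` `]-oo, x0]) (p 0%N w) : R)%:E).
  by apply/measurable_EFinP; apply: measurable_indic_rate; exact: measurableC.
rewrite ge0_integralD//; last 2 first.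
- by move=> w _; rewrite mule_ge0// lee_fin.
- by apply: emeasurable_funM => //; exact: measurable_cst.
rewrite ge0_integralZl_EFin//.
have -> : (\int[P]_w (\1_`]-oo, x0] (p 0%N w))%:E = (F x0)%:E)%E.
  by rewrite -(rate_cdf_le hp 0) -[in RHS](setIT (_ @^-1` _)) -integral_indic.
have -> : (\int[P]_w (\1_(~` `]-oo, x0]) (p 0%N w))%:E = (1 - F x0)%:E)%E.
  transitivity (P (~` (p 0%N @^-1` `]-oo, x0]))).
    rewrite -[in RHS](setIT (~` _)) -integral_indic//; exact: measurableC.
  by rewrite probability_setC// (rate_cdf_le hp 0).
by rewrite -EFinM -EFinD lee_fin; lra.
Qed.

End one_interval.

(** * Averages over finite matrices of bits *)

Section bit_matrices.
Context {R : realType}.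
Implicit Types (qs : seq R) (bs : seq bool).

Fixpoint all_bits n : seq (seq bool) :=
  if n is n'.+1 then map (cons true) (all_bits n') ++ map (cons false) (all_bits n')
  else [:: [::]].

Fixpoint all_rows M (l : seq (seq bool)) : seq (seq (seq bool)) :=
  if M is M'.+1 then [seq bs :: rows | bs <- l, rows <- all_rows M' l] else [:: [::]].

Definition bits_weight qs bs : R :=
  \prod_(k < size qs) (if nth false bs k then nth 0 qs k else 1 - nth 0 qs k).

Lemma mem_all_bits bs : bs \in all_bits (size bs).
Proof.
elim: bs => [//|b bs ih] /=; rewrite mem_cat.
by case: b; rewrite map_f ?orbT.
Qed.

Lemma mem_all_rows (l : seq (seq bool)) (rows : seq (seq bool)) :
  all (fun bs => bs \in l) rows -> rows \in all_rows (size rows) l.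
Proof.
elim: rows => [//|b rows ih] /= /andP[bl hrows]; apply/allpairsP.
by exists (b, rows); split => //; exact: ih.
Qed.

Lemma bits_mean_sum qs f : bits_mean qs f =
  \sum_(bs <- all_bits (size qs)) bits_weight qs bs * f bs.
Proof.
elim: qs f => [|q qs ih] f /=.
  by rewrite big_seq1 /bits_weight /= big_ord0 mul1r.
rewrite big_cat !big_map /= /bern_mean !ih !mulr_sumr.
by congr (_ + _); apply: eq_bigr => bs _; rewrite [in RHS]/bits_weight big_ord_recl mulrA.
Qed.

(** The iterated average as a sum over bit matrices, to be matched with the partition of the
    probability space by the observed matrix of rings. *)
Lemma tasep_mean_sum qs M g xs : tasep_mean qs M g xs =
  \sum_(rows <- all_rows M (all_bits (size qs)))
    (\prod_(bs <- rows) bits_weight qs bs) * g (foldl tasep_step xs rows).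
Proof.
elim: M xs => [|M ih] xs /=; first by rewrite big_seq1 big_nil mul1r.
rewrite bits_mean_sum big_allpairs_dep; apply: eq_bigr => bs _.
rewrite ih mulr_sumr; apply: eq_bigr => rows _.
by rewrite big_cons mulrA.
Qed.

End bit_matrices.

(** * Observing the clocks on a time grid *)

Section discretization.
Context {R : realType} {d : measure_display} {T : measurableType d}.
Variable P : probability T R.
Variables (p : nat -> {RV P >-> R}) (N : nat -> R -> {RV P >-> nat}).
Hypothesis hN : poisson_clocks_given_rates p N.
Variable delta : R.
Hypothesis delta0 : 0 < delta.

Let s (i : nat) : R := i%:R * delta.

Definition ring_probs K w : seq R := mkseq (fun k => 1 - expR (- (p k w * delta))) K.

Definition ring_bits K i w : seq bool :=
  mkseq (fun k => (N k (s i) w < N k (s i.+1) w)%N) K.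

Lemma increment_in_gt0 k i w :
  (N k (s i) w < N k (s i.+1) w)%N <-> increment_in N k (s i) (s i.+1) (predC1 0%N) w.
Proof.
split => [h|[v /= v0 ->]]; last by rewrite -[ltnLHS]addn0 ltn_add2l lt0n.
exists (N k (s i.+1) w - N k (s i) w)%N; last by rewrite subnKC// ltnW.
by rewrite /= subn_eq0 -ltnNge.
Qed.

Lemma measurable_ring_bits K M (rows : seq (seq bool)) (B : set T) :
  rate_events p B -> size rows = M -> all (fun bs => size bs == K) rows ->
  measurable (B `&` [set w | mkseq (ring_bits K ^~ w) M = rows]).
Proof.
move=> hB sM hrows; apply: measurableI; first exact: (rate_eventsS hB).
pose b k i := nth false (nth [::] rows i) k.
rewrite (_ : [set w | _] = \bigcap_(k in `I_K) \bigcap_(i in `I_M)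
  (if b k i then increment_in N k (s i) (s i.+1) (predC1 0%N)
   else ~` increment_in N k (s i) (s i.+1) (predC1 0%N))); last first.
  apply/seteqP; split => w /=.
    move=> rE k /= kK i /= iM.
    have -> : b k i = (N k (s i) w < N k (s i.+1) w)%N.
      by rewrite /b -rE nth_mkseq// nth_mkseq.
    by case: ifPn => h; [|apply: contraNnot h]; rewrite -increment_in_gt0.
  move=> h; apply: (@eq_from_nth _ [::]); rewrite size_mkseq ?sM// => i iM.
  rewrite nth_mkseq//; apply: (@eq_from_nth _ false); rewrite size_mkseq.
    by rewrite (eqP (all_nthP [::] hrows i _)) ?sM.
  move=> k kK; rewrite nth_mkseq// -/(b k i).
  have := h k kK i iM; case: ifP => _ /=; first by move/increment_in_gt0.
  by move=> hn; apply/negbTE/negP => /increment_in_gt0.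
apply: bigcap_measurableType => k _; apply: bigcap_measurableType => i _.
by case: ifP => _; [|apply: measurableC]; exact: measurable_increment_in.
Qed.

Lemma ring_bits_le K M (rows : seq (seq bool)) (B : set T) :
  rate_events p B -> (forall k w, B w -> (k < K)%N -> 0 < p k w) ->
  size rows = M -> all (fun bs => size bs == K) rows ->
  (P (B `&` [set w | mkseq (ring_bits K ^~ w) M = rows]) <=
   \int[P]_(w in B) (\prod_(bs <- rows) bits_weight (ring_probs K w) bs)%:E)%E.
Proof.
move=> hB pB sM hrows.
have mB := rate_eventsS hB.
have s0 : 0 <= s 0%N by rewrite /s mul0r.
have sE i : s i.+1 - s i = delta.
  by rewrite /s -mulrBl -natr1 addrAC subrr add0r mul1r.
have ss i : s i < s i.+1 by rewrite -subr_gt0 sE.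
pose b k i := nth false (nth [::] rows i) k.
pose E (e : nat * nat) : pred nat := fun v => if b e.1 e.2 then v != 0%N else v == 0%N.
(* The maximum keeps the bound nonnegative outside B, where the rates are not known to be
   positive. *)
pose q k w : R := Num.max 0 (1 - expR (- (p k w * delta))).
pose m (e : nat * nat) w : R := if b e.1 e.2 then q e.1 w else expR (- (p e.1 w * delta)).
have mexp k : measurable_fun setT (fun w => expR (- (p k w * delta))).
  apply: measurableT_comp => //; apply: measurable_funN.
  by apply: measurable_funM => //; exact: measurable_cst.
have mm e : measurable_fun setT (m e).
  rewrite /m; case: (b _ _) => //; apply: measurable_maxr; first exact: measurable_cst.
  by apply: measurable_funB => //; exact: measurable_cst.
have m0 e w : 0 <= m e w.
  by rewrite /m; case: (b _ _); rewrite ?expR_ge0// /q le_max lexx.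
have qE k w : (k < K)%N -> B w -> q k w = 1 - expR (- (p k w * delta)).
  move=> kK Bw; apply/max_idPr; rewrite subr_ge0 -expR0 ler_expR oppr_le0.
  by rewrite mulr_ge0// ltW// pB.
have hm k i w : (k < K)%N -> (i < M)%N -> B w ->
    (\sum_(0 <= v <oo | E (k, i) v) (poisson_pmf (p k w * (s i.+1 - s i)) v)%:E
     <= (m (k, i) w)%:E)%E.
  move=> kK iM Bw; have r0 : 0 < p k w * delta by rewrite mulr_gt0// pB.
  rewrite sE /m /E /=; case: (b k i).
    by rewrite qE//; exact: poisson_pmf_sum_neq0.
  rewrite (@nneseriesD1 _ _ 0%N)//; last by move=> v _; rewrite lee_fin poisson_pmf_ge0.
  rewrite eseries_pred0 ?adde0; last by move=> v; rewrite andbN.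
  by rewrite lee_fin /poisson_pmf r0 expr0 fact0 invr1 !mul1r.
have := clock_pattern_le hN s0 ss hB mm m0 hm.
set B' := (X in P (B `&` X)) => hB'.
have mB' : measurable B'.
  rewrite (_ : B' = \bigcap_(k in `I_K) \bigcap_(i in `I_M)
    increment_in N k (s i) (s i.+1) (E (k, i))); last first.
    by apply/seteqP; split => w /= h' k hk i hi; exact: h'.
  apply: bigcap_measurableType => k _; apply: bigcap_measurableType => i _.
  exact: measurable_increment_in.
apply: (@le_trans _ _ (P (B `&` B'))).
  apply: le_measure_ae; [exact: measurable_ring_bits|exact: measurableI|].
  have := hN.1; apply: filterS => w hw [Bw rE]; split => // k i kK iM.
  have bE : b k i = (N k (s i) w < N k (s i.+1) w)%N.
    by rewrite /b -rE nth_mkseq// nth_mkseq.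
  have [_ /(_ (s i) (s i.+1)) + _] := hw k; rewrite (ltW (ss i)) => /(_ _ isT).
  have -> : 0 <= s i by rewrite /s mulr_ge0// ltW.
  move=> /(_ isT) le; exists (N k (s i.+1) w - N k (s i) w)%N; last by rewrite subnKC.
  by rewrite /E /= bE; case: ltnP => h; rewrite ?subn_eq0 -?ltnNge.
apply: le_trans hB' _; rewrite le_eqVlt; apply/orP; left; apply/eqP.
apply: eq_integral => w /set_mem Bw; congr (_%:E).
rewrite exchange_big /= (big_nth [::]) sM big_mkord; apply: eq_bigr => i _.
rewrite /bits_weight size_mkseq; apply: eq_bigr => k _.
by rewrite /m /= nth_mkseq// -/(b k i); case: ifP => _; rewrite ?qE// opprB addrC subrK.
Qed.

Lemma measurable_bits_weight K (rows : seq (seq bool)) : measurable_fun setT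
  (fun w => \prod_(bs <- rows) bits_weight (ring_probs K w) bs).
Proof.
apply: measurable_prod => bs _; rewrite /bits_weight.
under eq_fun do rewrite size_mkseq.
apply: measurable_prod => k _; under eq_fun do rewrite nth_mkseq//.
have mexp : measurable_fun setT (fun w => 1 - expR (- (p k w * delta))).
  apply: measurable_funB; first exact: measurable_cst.
  apply: measurableT_comp => //; apply: measurable_funN.
  by apply: measurable_funM => //; exact: measurable_cst.
case: (nth false bs k) => //.
by apply: measurable_funB => //; exact: measurable_cst.
Qed.

Lemma measurable_tasep_mean K M (g : seq nat -> R) (xs : seq nat) :
  measurable_fun setT (fun w => tasep_mean (ring_probs K w) M g xs).
Proof.
under eq_fun do rewrite tasep_mean_sum size_mkseq.
rewrite /=; elim: (all_rows _ _) => [|rows l ih].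
  by under eq_fun do rewrite big_nil; exact: measurable_cst.
under eq_fun do rewrite big_cons; apply: measurable_funD => //.
by apply: measurable_funM; [exact: measurable_bits_weight|exact: measurable_cst].
Qed.

(** A union bound over the finitely many bit matrices that lead to [g], each controlled by
    [ring_bits_le]; the weights resum to [tasep_mean]. *)
Lemma tasep_event_le K M (A B : set T) (g : seq nat -> bool) :
  measurable A -> rate_events p B -> (forall k w, B w -> (k < K)%N -> 0 < p k w) ->
  (forall w, A w -> B w /\
    g (foldl tasep_step (nseq K 0%N) (mkseq (ring_bits K ^~ w) M))) ->
  (P A <= \int[P]_(w in B)
    (tasep_mean (ring_probs K w) M (fun xs => (g xs)%:R) (nseq K 0%N))%:E)%E.
Proof.
move=> mA hB pB hA; have mB := rate_eventsS hB.
pose l := [seq rows <- all_rows M (all_bits K) | g (foldl tasep_step (nseq K 0%N) rows)].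
pose C rows := B `&` [set w | mkseq (ring_bits K ^~ w) M = rows].
have hl rows : rows \in all_rows M (all_bits K) ->
    size rows = M /\ all (fun bs => size bs == K) rows.
  have hb n bs : bs \in all_bits n -> size bs = n.
    elim: n bs => [|n ih] bs /=; first by rewrite inE => /eqP ->.
    by rewrite mem_cat => /orP[] /mapP[bs' /ih <- ->].
  elim: M rows {l C hA} => [|M' ih] rows /=; first by rewrite inE => /eqP ->.
  move=> /allpairsP[[bs rows'] [/= hbs hrows ->]] /=.
  by have [-> ->] := ih _ hrows; rewrite (hb _ _ hbs) eqxx.
have bits_in w : mkseq (ring_bits K ^~ w) M \in all_rows M (all_bits K).
  rewrite -[X in all_rows X](size_mkseq (ring_bits K ^~ w) M); apply: mem_all_rows.
  apply/allP => bs /mapP[i _ ->].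
  rewrite -[X in all_bits X](size_mkseq (fun k => (N k (s i) w < N k (s i.+1) w)%N) K).
  exact: mem_all_bits.
have mW := measurable_bits_weight K.
have W0 rows w : B w -> 0 <= \prod_(bs <- rows) bits_weight (ring_probs K w) bs.
  move=> Bw; apply: prodr_ge0 => bs _; rewrite /bits_weight; apply: prodr_ge0 => k _.
  have kK : (k < K)%N by have := ltn_ord k; rewrite [X in (_ < X)%N]size_mkseq.
  rewrite nth_mkseq//; case: ifP => _; last by rewrite opprB addrC subrK expR_ge0.
  rewrite subr_ge0 -expR0 ler_expR oppr_le0 mulr_ge0// ltW//; exact: pB.
have mC rows : rows \in l -> measurable (C rows).
  rewrite mem_filter => /andP[_ /hl [sM hr]]; exact: measurable_ring_bits.
apply: (@le_trans _ _ (\sum_(rows <- l) P (C rows))%E).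
  have : forall A, measurable A ->
      (forall w, A w -> exists2 rows, rows \in l & C rows w) ->
      (P A <= \sum_(rows <- l) P (C rows))%E.
    elim: l mC => [|rows l ih] mC' A' mA' hA'.
      rewrite big_nil (_ : A' = set0) ?measure0//.
      by apply/seteqP; split => // w /hA' [].
    rewrite big_cons.
    apply: (@le_trans _ _ (P (C rows `|` (A' `\` C rows)))).
      apply: le_measure; rewrite ?inE//.
        apply: measurableU; first by apply: mC'; rewrite mem_head.
        by apply: measurableD => //; apply: mC'; rewrite mem_head.
      by move=> w A'w; have [|] := pselect (C rows w); [left|right].
    have mCr : measurable (C rows) by apply: mC'; rewrite mem_head.
    apply: le_trans (measureU2 _ _ _) _ => //; first exact: measurableD.
    apply: leeD => //; apply: ih.
    - by move=> r rl; apply: mC'; rewrite inE rl orbT.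
    - exact: measurableD.
    - move=> w [A'w nC]; have [r + Cr] := hA' w A'w.
      by rewrite inE => /orP[/eqP re|rl]; [rewrite re in Cr|exists r].
  apply => // w Aw; have [Bw gw] := hA w Aw.
  by exists (mkseq (ring_bits K ^~ w) M) => //; rewrite mem_filter gw bits_in.
apply: (@le_trans _ _ (\sum_(rows <- l) \int[P]_(w in B)
    (\prod_(bs <- rows) bits_weight (ring_probs K w) bs)%:E)%E).
  rewrite big_seq [leRHS]big_seq; apply: lee_sum => rows.
  rewrite mem_filter => /andP[_ /hl [sM hr]]; exact: ring_bits_le.
have mWe rows : measurable_fun B (fun w =>
    (\prod_(bs <- rows) bits_weight (ring_probs K w) bs)%:E).
  by apply/measurable_EFinP; exact: measurable_funTS.
have W0e rows w : B w ->
    (0 <= (\prod_(bs <- rows) bits_weight (ring_probs K w) bs)%:E)%E.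
  by move=> Bw; rewrite lee_fin W0.
rewrite -(ge0_integral_sum P mB mWe W0e l).
rewrite le_eqVlt; apply/orP; left; apply/eqP; apply: eq_integral => w /set_mem Bw.
rewrite sumEFin; congr (_%:E).
rewrite tasep_mean_sum size_mkseq big_filter big_mkcond; apply: eq_bigr => rows _ /=.
by case: ifP => _; rewrite ?mulr1 ?mulr0.
Qed.

End discretization.

(** * The discrete process as a lower bound of the trajectories *)

Section discrete_below_continuous.
Context {R : realType}.
Variables (n : nat -> R -> nat) (x : nat -> R -> int).
Hypotheses (hn : forall k, counting_path (n k)) (hx : exclusion_path n x).

Lemma nth_exclusion_step X (xs : seq nat) (bs : seq bool) k :
  (k < size xs)%N -> size bs = size xs ->
  nth 0%N (exclusion_step X xs bs) k = (nth 0 xs k +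
    (nth false bs k && (nth 0 xs k < (if k is k'.+1 then nth 0 xs k' else X))))%N.
Proof.
elim: xs bs X k => [|y xs ih] [|b bs] X [|k] //= kx [sbs].
by rewrite ih//; case: k kx.
Qed.

(** A discrete particle could get ahead of the true one only from equality. Its discrete predecessor
    is then strictly ahead in jump count and itself not ahead of the true predecessor, so the true
    particle has a gap when the time step starts, and [position_jump] moves it too. *)
Lemma tasep_below_path (K M : nat) (delta : R) : 0 < delta ->
  let s (i : nat) := i%:R * delta in
  let z := foldl tasep_step (nseq K 0%N)
    (mkseq (fun i => mkseq (fun k => (n k (s i) < n k (s i.+1))%N) K) M) in
  size z = K /\ forall k, (k < K)%N -> (nth 0%N z k)%:Z <= x k (s M) + k%:Z.
Proof.
move=> delta0 s z; rewrite {}/z.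
pose b i := mkseq (fun k => (n k (s i) < n k (s i.+1))%N) K.
pose z i := foldl tasep_step (nseq K 0%N) (mkseq b i).
rewrite -/(z M).
have zS i : z i.+1 = tasep_step (z i) (b i) by rewrite /z mkseqS foldl_rcons.
have sz i : size (z i) = K.
  elim: i => [|i ih]; first by rewrite /z size_nseq.
  by rewrite zS size_tasep_step ih// size_mkseq.
have s0 i : 0 <= s i by rewrite /s mulr_ge0// ltW.
have ss i : s i < s i.+1 by rewrite /s ltr_pM2r// ltr_nat.
split; first exact: sz.
elim: M => [|i ih] k kK.
  by rewrite /z /= nth_nseq kK /s mul0r; have [-> _ _] := hx k; rewrite addNr.
rewrite zS nth_exclusion_step ?sz ?size_mkseq// nth_mkseq//.
have mono := position_ge hx k (s0 i) (ltW (ss i)).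
have ihk := ih k kK.
case: andP => [[rings gap]|_] /=; last by rewrite addn0; apply: le_trans ihk _; rewrite lerD2r.
have jump : (nth 0 (z i) k)%:Z = x k (s i) + k%:Z -> x k (s i) + 1 <= x k (s i.+1).
  move=> eqk; apply: (position_jump hn hx) => //.
  case: k kK mono ihk rings gap eqk => // k kK _ _ _ gap eqk.
  have := ih k (ltnW kK); move: gap eqk.
  move: (nth _ _ _) (nth _ _ _) (x k (s i)) (x k.+1 (s i)) => u v y1 y2 *; lia.
move: mono ihk jump.
move: (nth _ _ _) (x k (s i)) (x k (s i.+1)) => u y1 y2 mono ihk jump.
have [e|ne] := eqVneq u%:Z (y1 + k%:Z); first by have := jump e; lia.
by lia.
Qed.

End discrete_below_continuous.

Lemma tasep_mean_ge0 {R : realType} (qs : seq R) M g xs : all is_prob qs ->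
  (forall xs, 0 <= g xs) -> 0 <= tasep_mean qs M g xs.
Proof.
move=> hq g0; elim: M xs => [//|M ih] xs /=; exact: bits_mean_ge0.
Qed.

(** * Lower bound on the event that no rate is slow *)

Section slow_rates.
Context {R : realType} {d : measure_display} {T : measurableType d}.
Variable P : probability T R.
Variables (F : cumulativeBounded (0 : R) (1 : R)) (p : nat -> {RV P >-> R}).
Variables (N : nat -> R -> {RV P >-> nat}) (xi : nat -> R -> T -> int).
Hypothesis process : disordered_exclusion F p N xi.

Lemma rates_in_le (K : nat) (x y : R) : x <= y ->
  P [set w | forall k, (k < K)%N -> `]x, y]%classic (p k w)] = ((F y - F x) ^+ K)%:E.
Proof.
move=> xy; have hp := rates_iid process.
have := @independent_preimages _ _ _ _ _ _ hp K 1 (fun=> `]x, y]%classic) (fun=> ord0)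
  (fun=> measurable_itv _).
rewrite prodr_const card_ord => h.
transitivity (P [set w | forall k : 'I_K, `]x, y]%classic (p k w)]).
  congr (P _); apply/seteqP; split => w /= hw k; first exact: hw.
  by move=> kK; exact: (hw (Ordinal kK)).
rewrite h; congr ((_ ^+ _)%:E).
by have -> : P (p 0%N @^-1` `]x, y]) = (F y - F x)%:E := rate_itv_oc hp 0 xy.
Qed.

Lemma measurable_beyond n (t r : R) : 0 <= t -> measurable [set w | r < (xi n t w)%:~R].
Proof.
move=> t0; rewrite (_ : [set w | _] =
    \bigcup_(z : int) (if r < z%:~R then [set w | xi n t w = z] else set0)).
  apply: countable_bigcupT_measurable => // z.
  by case: ifP => // _; exact: (positions_measurable process).
apply/seteqP; split => w /=; first by move=> h; exists (xi n t w) => //; rewrite h.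
by move=> [z _]; case: ifP => // h /= ->.
Qed.

(** The left side is the probability of the event B that the n + 1 rates lie in ]x0, 1]. On B,
    either particle n is beyond ct, or it has made at most ct + n = r1 - r2 jumps and
    [tasep_mean_tail] applies. The function [h] dominates the factor contributed by one rate and is
    averaged by independence. *)
Lemma beyond_ge (c x0 t a theta r1 r2 C gam : R) (n M : nat) (h : R -> R) :
  0 <= x0 -> x0 <= 1 -> 0 < t -> (0 < M)%N -> 0 < a -> a <= 1 -> 0 <= theta ->
  0 <= gam -> r1 - r2 = c * t + n%:R ->
  let q (y : R) : R := 1 - expR (- (y * (t / M%:R))) in
  (forall y, x0 < y -> y <= 1 -> a < q y /\ (expR theta - 1) * a < q y - a) ->
  measurable_fun setT h -> (forall y, 0 <= h y) -> (forall y, h y <= C) ->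
  (forall y, x0 < y -> y <= 1 -> queue_gen a (expR theta) (q y) <= h y) ->
  (\int[P]_w (h (p 0%N w))%:E <= gam%:E)%E ->
  (((F 1 - F x0) ^+ n.+1)%:E <= P [set w | (c * t < (xi n t w)%:~R)%R] +
    (expR (theta * r1) * (1 - a + a * expR (- theta)) ^+ M
     + expR (- (theta * r2)) * gam ^+ n.+1)%:E)%E.
Proof.
move=> x00 x01 t0 M0 a0 a1 th0 gam0 r12 q hq mh h0 hC hqh hint.
have hp := rates_iid process; have hN := clocks_poisson process.
set e1 := expR (theta * r1) * _; set k2 := expR (- (theta * r2)).
have e10 : 0 <= e1.
  rewrite /e1 mulr_ge0 ?expR_ge0// exprn_ge0// addr_ge0 ?subr_ge0// mulr_ge0 ?expR_ge0//.
  exact: ltW.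
have k20 : 0 <= k2 by exact: expR_ge0.
pose delta := t / M%:R.
have delta0 : 0 < delta by rewrite divr_gt0// ltr0n.
pose K := n.+1.
pose B : set T := [set w | forall k, (k < K)%N -> `]x0, 1]%classic (p k w)].
have hB : rate_events p B by exact: rate_events_forall.
have mB := rate_eventsS hB.
have pB k w : B w -> (k < K)%N -> 0 < p k w.
  by move=> Bw kK; have := Bw k kK; rewrite /= in_itv /= => /andP[+ _]; exact: le_lt_trans.
pose E := [set w | c * t < (xi n t w)%:~R].
have mE : measurable E by exact: measurable_beyond (ltW t0).
pose A := B `\` E.
have mA : measurable A by exact: measurableD.
pose g (xs : seq nat) := (last 0%N xs)%:R <= r1 - r2.
have hA : {ae P, forall w, A w -> B w /\
    g (foldl tasep_step (nseq K 0%N) (mkseq (ring_bits N delta K ^~ w) M))}.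
  have := positions_dynamics process; have := hN.1; apply: filterS2 => w hn hx [Bw nE].
  split => //; rewrite /g r12.
  have := tasep_below_path hn hx K M delta0.
  rewrite -/K; set z := foldl _ _ _ => -[sz /(_ n (ltnSn n)) hz].
  have <- : nth 0%N z n = last 0%N z by rewrite -nth_last sz.
  have tM : M%:R * delta = t by rewrite /delta mulrC divfK// gt_eqF// ltr0n.
  rewrite tM in hz.
  have : ((xi n t w)%:~R <= c * t) by rewrite leNgt; apply/negP.
  move: hz; rewrite -(ler_int R) rmorphD /=; lra.
(* The comparison holds almost surely, whereas [tasep_event_le] asks for it at every point: the null
   set is removed from A. *)
have [Z [mZ PZ hZ]] := hA.
have mAZ : measurable (A `\` Z) by exact: measurableD.
have PA : (P A <= \int[P]_(w in B)
    (tasep_mean (ring_probs p delta K w) M (fun xs => (g xs)%:R) (nseq K 0%N))%:E)%E.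
  apply: (@le_trans _ _ (P (A `\` Z))).
    apply: le_measure_ae => //; exists Z; split => // w /= hw.
    by apply: contrapT => nZ; apply: hw.
  apply: (tasep_event_le hN delta0) => // w [Aw nZ].
  by apply: contrapT => hw; apply: nZ; apply: hZ => /= /(_ Aw).
have PB : P B = ((F 1 - F x0) ^+ K)%:E by exact: rates_in_le.
rewrite -PB; apply: (@le_trans _ _ (P E + P A)%E).
  apply: (@le_trans _ _ (P (E `|` A))); last exact: measureU2.
  apply: le_measure; rewrite ?inE//; first exact: measurableU.
  by move=> w Bw; have [|] := pselect (E w); [left|right].
apply: leeD => //; apply: le_trans PA _.
have mprod : measurable_fun setT (fun w => (\prod_(k < K) h (p k w))%:E).
  by apply/measurable_EFinP; apply: measurable_prod => k _; exact: (measurableT_comp mh).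
have hw w : B w -> forall k, (k < K)%N -> [/\ x0 < p k w, p k w <= 1 &
    nth 0 (ring_probs p delta K w) k = q (p k w)].
  move=> Bw k kK; have := Bw k kK; rewrite /= in_itv /= => /andP[? ?]; split => //.
  by rewrite nth_mkseq.
have hall w (Q : R -> bool) : B w -> (forall y, x0 < y -> y <= 1 -> Q (q y)) ->
    all Q (ring_probs p delta K w).
  move=> Bw hQ; apply/(all_nthP 0) => k; rewrite size_mkseq => kK.
  by have [h1 h2 ->] := hw w Bw k kK; exact: hQ.
have hst w : B w -> all (stable a) (ring_probs p delta K w).
  move=> Bw; apply: hall => // y y0 y1; have [aq _] := hq y y0 y1.
  by rewrite /stable a0 aq /q gtrBl expR_gt0.
apply: (@le_trans _ _ (\int[P]_(w in B) (e1%:E + k2%:E * (\prod_(k < K) h (p k w))%:E))%E).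
  apply: ge0_le_integral => //.
  - move=> w Bw; rewrite lee_fin; apply: tasep_mean_ge0 => //.
    by apply: sub_all (hst w Bw) => y /and3P[? ? ?]; rewrite /is_prob; lra.
  - by apply/measurable_EFinP; apply: measurable_funTS; exact: measurable_tasep_mean.
  - apply: measurable_funTS; apply: emeasurable_funD; first exact: measurable_cst.
    by apply: emeasurable_funM => //; exact: measurable_cst.
  move=> w Bw; rewrite -EFinM -EFinD lee_fin.
  rewrite -[K in nseq K _](size_mkseq (fun k => 1 - expR (- (p k w * delta))) K).
  apply: le_trans (tasep_mean_tail M r1 r2 _ (hst w Bw) _ th0 _) _.
  - by rewrite size_mkseq.
  - by rewrite /is_prob; lra.
  - by apply: hall => // y y0 y1; have [_] := hq y y0 y1.
  rewrite lerD2l ler_wpM2l// (big_nth 0) size_mkseq big_mkord; apply: ler_prod => k _.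
  have [h1 h2 ->] := hw w Bw k (ltn_ord k).
  rewrite hqh// andbT; have [aq sq] := hq _ h1 h2.
  have qa : 0 < q (p k w) - a by rewrite subr_gt0.
  have es : 0 <= expR theta - 1 by rewrite subr_ge0 -expR0 ler_expR.
  rewrite /queue_gen divr_ge0//; first by rewrite addr_ge0// mulr_ge0// ltW.
  by rewrite subr_ge0 mulrA ler_pdivrMr// mul1r ltW.
apply: (@le_trans _ _ (\int[P]_w (e1%:E + k2%:E * (\prod_(k < K) h (p k w))%:E))%E).
  apply: ge0_subset_integral => //.
    apply: emeasurable_funD; first exact: measurable_cst.
    by apply: emeasurable_funM => //; exact: measurable_cst.
  by move=> w _; rewrite -EFinM -EFinD lee_fin addr_ge0// mulr_ge0// prodr_ge0.
rewrite ge0_integralD//; last 2 first.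
- by move=> w _; rewrite -EFinM lee_fin mulr_ge0// prodr_ge0.
- by apply: emeasurable_funM => //; exact: measurable_cst.
rewrite integral_cst// [X in (_ * X + _)%E](_ : _ = 1%E); last exact: probability_setT.
rewrite mule1 EFinD leeD2l// ge0_integralZl_EFin//; last first.
  by move=> w _; rewrite lee_fin prodr_ge0.
rewrite EFinM; apply: lee_wpmul2l; first by rewrite lee_fin.
exact: (integral_prod_le hp _ mh h0 hC hint gam0).
Qed.

End slow_rates.

(** * From the number of particles beyond ct to one particle *)

Section counting_particles.
Context {R : realType} {d : measure_display} {T : measurableType d}.
Variable P : probability T R.
Variables (F : cumulativeBounded (0 : R) (1 : R)) (p : nat -> {RV P >-> R}).
Variables (N : nat -> R -> {RV P >-> nat}) (xi : nat -> R -> T -> int).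
Hypothesis process : disordered_exclusion F p N xi.

Lemma num_beyond_gtP (c r t : R) (x : nat -> R -> int) : 0 <= r ->
  (r%:E < num_beyond c x t)%E <->
  exists k : nat, [/\ (0 < k)%N, c * t < (x k.-1 t)%:~R & r < k%:R].
Proof.
move=> r0; rewrite /num_beyond; split.
  rewrite lt_max => /orP[|/ereal_sup_gt [_ [k [k0 kx] <-]] rk].
    by rewrite ltNge lee_fin r0.
  by exists k; split => //; rewrite -lte_fin.
move=> [k [k0 kx rk]]; rewrite lt_max; apply/orP; right.
apply: (@lt_le_trans _ _ (k%:R)%:E); first by rewrite lte_fin.
by apply: ereal_sup_ubound; exists k.
Qed.

Lemma measurable_num_beyond (c r t : R) : 0 <= r -> 0 <= t ->
  measurable [set w | (r%:E < num_beyond c (fun k s => xi k s w) t)%E].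
Proof.
move=> r0 t0; rewrite (_ : [set w | _] = \bigcup_k
    (if (0 < k)%N && (r < k%:R) then [set w | c * t < (xi k.-1 t w)%:~R] else set0)).
  apply: bigcup_measurable => k _; case: ifP => // _.
  exact: (measurable_beyond process).
apply/seteqP; split => w /=.
  by move=> /(num_beyond_gtP _ _ _ r0) [k [k0 kx rk]]; exists k => //; rewrite k0 rk.
move=> [k _]; case: ifP => // /andP[k0 rk] /= kx.
by apply/(num_beyond_gtP _ _ _ r0); exists k.
Qed.

(** The least k > r is [(Num.truncn r).+1], whose particle is encoded by [Num.truncn r]. Since the
    particles are ordered, if some particle with k > r is beyond ct then so is this one. *)
Lemma prob_num_beyond (c r t : R) : 0 <= r -> 0 <= t ->
  P [set w | (r%:E < num_beyond c (fun k s => xi k s w) t)%E] =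
  P [set w | c * t < (xi (Num.truncn r) t w)%:~R].
Proof.
move=> r0 t0; set A := [set w | _ ]; set B := [set w | _].
have mA : measurable A by exact: measurable_num_beyond.
have mB : measurable B by exact: (measurable_beyond process).
apply/eqP; rewrite eq_le; apply/andP; split; apply: le_measure_ae => //.
  have := positions_dynamics process; apply: filterS => w hx.
  move=> /(num_beyond_gtP _ _ _ r0) [k [k0 kx rk]].
  apply: lt_le_trans kx _; rewrite ler_int.
  have h : (Num.truncn r <= k.-1)%N.
    by rewrite -ltnS prednK// truncn_lt_nat.
  have := positionD_le hx (Num.truncn r) (k.-1 - Num.truncn r) t0.
  rewrite subnK//; apply: le_trans.
  by rewrite lerDl.
apply: aeW => w /= Bw; apply/(num_beyond_gtP _ _ _ r0).
by exists (Num.truncn r).+1; split => //; exact: truncnS_gt.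
Qed.

End counting_particles.

(** * The critical gap *)

Section gap_integral.
Context {R : realType} {d : measure_display} {T : measurableType d}.
Variable P : probability T R.
Variables (F : cumulativeBounded (0 : R) (1 : R)) (p : nat -> {RV P >-> R}).
Hypothesis hp : iid_with_cdf F p.
Variables (c nu kappa : R).
Hypotheses (c0 : 0 < c) (F_supp : supported_on_oc F c) (nu0 : 0 < nu) (kappa0 : 0 < kappa).
Hypothesis F_tail : F x / (x - c) `^ (nu + 1) @[x --> c^'+] --> kappa.

Lemma cdf_itv01 x : 0 <= F x <= 1.
Proof.
rewrite -!lee_fin -(rate_cdf_le hp 0) measure_ge0 /=.
by apply: probability_le1; exact: measurable_funPTI.
Qed.

Lemma left_endpoint_lt1 : c < 1.
Proof.
have [F0 Fc _ F1] := F_supp; rewrite ltNge; apply/negP.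
rewrite le_eqVlt => /orP[/eqP e|/F0]; first by move: Fc; rewrite -e F1 => /eqP; rewrite oner_eq0.
by rewrite F1 => /eqP; rewrite oner_eq0.
Qed.

(** Within distance e of c this is the tail hypothesis with kappa + 1 in place of kappa; farther
    away F <= 1 and (h / e)^(nu+1) >= 1. *)
Lemma cdf_power_bound : exists2 C, 0 <= C & forall h, 0 < h -> F (c + h) <= C * h `^ (nu + 1).
Proof.
have /cvgr_lt/(_ (kappa + 1)) := F_tail; rewrite ltrDl ltr01 => /(_ isT) [e /= e0 he].
exists (kappa + 1 + (e `^ (nu + 1))^-1).
  by rewrite !addr_ge0 ?invr_ge0 ?powR_ge0// ltW.
move=> h h0; have hp0 : 0 < h `^ (nu + 1) by exact: powR_gt0.
have ep0 : 0 < e `^ (nu + 1) by exact: powR_gt0.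
rewrite mulrDl; have [he'|eh] := ltP h e.
  have := he (c + h); rewrite /= opprD addrA subrr sub0r normrN gtr0_norm// he' => /(_ isT).
  have ch : c + h - c = h by lra.
  rewrite ltrDl h0 ch => /(_ isT); rewrite ltr_pdivrMr// => hlt.
  by rewrite ltW// (lt_le_trans hlt)// lerDl mulr_ge0// ltW// invr_gt0.
have /andP[_ F1] := cdf_itv01 (c + h); apply: le_trans F1 _.
rewrite -[leLHS]add0r lerD//; first by rewrite mulr_ge0 ?ltW// addr_gt0.
rewrite mulrC ler_pdivlMr// mul1r.
by apply: ge0_ler_powR; rewrite ?nnegrE ?addr_ge0 ?ler01 ?(ltW nu0) ?(ltW e0) ?(ltW h0).
Qed.

Lemma integral_law (D : set R) (f : R -> \bar R) : measurable D ->
  measurable_fun D f -> (forall x, D x -> (0 <= f x)%E) ->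
  (\int[lebesgue_stieltjes_measure F]_(x in D) f x =
   \int[P]_(w in p 0%N @^-1` D) f (p 0%N w))%E.
Proof.
move=> mD mf f0.
have mX : measurable_fun setT (p 0%N : T -> measurableTypeR R).
  by move=> _ Y mY; rewrite setTI; exact: (measurable_funPTI (p 0%N) (Y := Y)).
pose X : {mfun T >-> measurableTypeR R} :=
  HB.pack (p 0%N : T -> measurableTypeR R) (isMeasurableFun.Build _ _ _ _ _ mX).
rewrite (eq_measure_integral (distribution P X)); last first.
  by move=> A mA _; symmetry; exact: (rate_law hp 0 mA).
rewrite /distribution ge0_integral_pushforward//.
by move=> y /set_mem; exact: f0.
Qed.

(** The inverse is written as a power with exponent -1, which is measurable and nonnegative
    everywhere and agrees with the inverse for x > m. *)
Lemma measurable_ratio (l m : R) : measurable_fun setT (fun x : R => l * (x - m) `^ (-1)).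
Proof.
apply: measurable_funM; first exact: measurable_cst.
apply: (measurableT_comp (measurable_powR _)).
by apply: measurable_funB => //; exact: measurable_cst.
Qed.

Lemma gapE : critical_gap F c =
  (\int[P]_(w in p 0%N @^-1` `]c, 1%R]) (c * (p 0%N w - c) `^ (-1))%:E)%E.
Proof.
rewrite /critical_gap -(integral_law (f := fun x => (c * (x - c) `^ (-1))%:E)) //.
- apply: eq_integral => x /set_mem; rewrite /= in_itv /= => /andP[cx _].
  by rewrite powR_inv1// subr_ge0 ltW.
- by apply/measurable_EFinP; apply: measurable_funTS; exact: measurable_ratio.
- by move=> x _; rewrite lee_fin mulr_ge0 ?powR_ge0// ltW.
Qed.

Lemma gap_ge0 : 0 <= fine (critical_gap F c).
Proof.
apply: fine_ge0; rewrite gapE; apply: integral_ge0 => w _.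
by rewrite lee_fin mulr_ge0 ?powR_ge0// ltW.
Qed.

Lemma dyadic_scale (l y : R) : 0 < y -> y <= l ->
  exists2 i : nat, y <= l / 2 ^+ i & l / 2 ^+ i < 2 * y.
Proof.
move=> y0 yl; have l0 : 0 < l by apply: lt_le_trans yl.
have ex : exists i : nat, l / 2 ^+ i < 2 * y.
  exists (Num.truncn (l / y)); set i := Num.truncn _.
  have li : l / y < i.+1%:R by exact: truncnS_gt.
  have i2 : i.+1%:R <= 2 ^+ i :> R by rewrite -natrX ler_nat ltn_expl.
  have : l < 2 ^+ i * y by rewrite -ltr_pdivrMr// (lt_le_trans li).
  have e0 : 0 < 2 ^+ i :> R by rewrite exprn_gt0.
  rewrite ltr_pdivrMr//; nra.
pose i := ex_minn ex.
exists i; last by rewrite /i; case: ex_minnP.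
rewrite /i; case: ex_minnP => -[|j] hj hmin; first by rewrite expr0 divr1.
have : ~~ (l / 2 ^+ j < 2 * y) by apply/negP => /hmin; rewrite ltnn.
rewrite -leNgt => h; have e0 : 2 ^+ j != 0 :> R by rewrite expf_neq0.
have -> : l / 2 ^+ j.+1 = l / 2 ^+ j / 2 by rewrite exprS; field.
lra.
Qed.

(** Dyadic decomposition: with h_i = (1 - c) / 2^i, the integrand at p is at most 2c / h_i for some
    i with p - c <= h_i. Level i contributes at most (2c / h_i) F(c + h_i), of order h_i^nu, which
    is summable because nu > 0. *)
Lemma gap_lty : (critical_gap F c < +oo)%E.
Proof.
have [C C0 hC] := cdf_power_bound; have c1 := left_endpoint_lt1.
have [F0 Fc _ F1] := F_supp.
pose l := 1 - c; have l0 : 0 < l by rewrite subr_gt0.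
pose h (i : nat) := l / 2 ^+ i.
have h0 i : 0 < h i by rewrite divr_gt0// exprn_gt0.
pose b (i : nat) := c * 2 / h i.
have b0 i : 0 <= b i by rewrite divr_ge0 ?ltW// mulr_gt0.
have mI i : measurable (p 0%N @^-1` `]c, c + h i]) by exact: measurable_funPTI.
rewrite gapE; apply: (@le_lt_trans _ _ (\int[P]_(w in p 0%N @^-1` `]c, 1%R])
   (\sum_(0 <= i <oo) (b i)%:E * (\1_(p 0%N @^-1` `]c, c + h i]) w)%:E))%E).
  apply: ge0_le_integral => //.
  - exact: measurable_funPTI.
  - by move=> w _; rewrite lee_fin mulr_ge0 ?powR_ge0// ltW.
  - apply/measurable_EFinP; apply: measurable_funTS.
    exact: (measurableT_comp (measurable_ratio c c)).
  - apply: ge0_emeasurable_sum => [i w _ _|i _].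
      by rewrite -EFinM lee_fin mulr_ge0.
    apply: measurable_funTS; apply: emeasurable_funM; first exact: measurable_cst.
    by apply/measurable_EFinP; exact: measurable_indic.
  move=> w; rewrite /= in_itv /= => /andP[cw w1].
  set y := p 0%N w in cw w1 *.
  have y0 : 0 < y - c by rewrite subr_gt0.
  have [i hi1 hi2] : exists2 i, y - c <= h i & h i < 2 * (y - c).
    by apply: dyadic_scale; rewrite /l ?subr_gt0//; lra.
  apply: (@le_trans _ _ ((b i)%:E * (\1_(p 0%N @^-1` `]c, c + h i]) w)%:E)%E).
    rewrite indicE mem_set ?mule1 ?lee_fin; last first.
      by rewrite /= in_itv /= cw -lerBlDl.
    rewrite /b powR_inv1 ?(ltW y0)// -mulrA ler_pM2l// ler_pdivlMr// mulrC ler_pdivrMr//.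
    exact: ltW.
  rewrite (@nneseriesD1 _ _ i)//; last by move=> j _; rewrite -EFinM lee_fin mulr_ge0.
  by rewrite leeDl// nneseries_ge0// => j _ _; rewrite -EFinM lee_fin mulr_ge0.
rewrite integral_nneseries//; last 3 first.
- exact: measurable_funPTI.
- move=> i; apply: measurable_funTS; apply: emeasurable_funM; first exact: measurable_cst.
  by apply/measurable_EFinP; exact: measurable_indic.
- by move=> i w _; rewrite -EFinM lee_fin mulr_ge0.
pose z := 2 `^ (- nu) : R.
pose A := c * 2 * C * l `^ nu.
have A0 : 0 <= A by rewrite /A !mulr_ge0 ?powR_ge0// ltW.
apply: (@le_lt_trans _ _ (\sum_(0 <= i <oo) (A * z ^+ i)%:E)%E).
  apply: lee_nneseries => // i _.
    by move=> _; apply: integral_ge0 => w _; rewrite -EFinM lee_fin mulr_ge0.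
  rewrite ge0_integralZl_EFin//; last 2 first.
  - exact: measurable_funPTI.
  - by apply: measurable_funTS; apply/measurable_EFinP; exact: measurable_indic.
  rewrite integral_indic//; last exact: measurable_funPTI.
  have hP : (P (p 0%N @^-1` `]c, (c + h i)%R] `&` p 0%N @^-1` `]c, 1%R]) <= (F (c + h i))%:E)%E.
    have <- : P (p 0%N @^-1` `]c, c + h i]) = (F (c + h i))%:E.
      rewrite -[F (c + h i)]subr0 -[X in _ - X]Fc.
      by apply: rate_itv_oc => //; rewrite lerDl ltW.
    apply: le_measure; rewrite ?inE//.
    by apply: measurableI => //; exact: measurable_funPTI.
  have hb : (0 <= (b i)%:E)%E by rewrite lee_fin.
  apply: (le_trans (lee_wpmul2l hb hP)); rewrite -EFinM lee_fin.
  apply: (@le_trans _ _ (b i * (C * h i `^ (nu + 1)))); first by rewrite ler_wpM2l ?hC.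
  rewrite le_eqVlt; apply/orP; left; apply/eqP.
  have e0 : 0 < 2 ^+ i :> R by rewrite exprn_gt0.
  have -> : z ^+ i = ((2 ^+ i) `^ nu)^-1.
    by rewrite /z -powR_mulrn ?powR_ge0// -powRrM -[2 ^+ i]powR_mulrn// -powRrM -powRN mulNr mulrC.
  have hE : h i `^ nu = l `^ nu * ((2 ^+ i) `^ nu)^-1.
    rewrite /h powRM ?invr_ge0 ?(ltW e0) ?(ltW l0)//; congr (_ * _).
    by rewrite -(powR_inv1 (ltW e0)) -powRrM mulN1r powRN.
  rewrite powRD; last by rewrite (gt_eqF (h0 i)) implybT.
  rewrite powRr1 ?(ltW (h0 i))// /A -[RHS]mulrA -hE /b; field.
  by rewrite gt_eqF.
have z0 : 0 < z by exact: powR_gt0.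
have z1 : `|z| < 1.
  rewrite gtr0_norm// /z powRN invf_lt1 ?powR_gt0// [ltLHS](_ : _ = 1 `^ nu); last by rewrite powR1.
  by apply: gt0_ltr_powR => //; rewrite ?nnegrE// ltr1n.
apply: (@le_lt_trans _ _ (A / (1 - z))%:E); last exact: ltry.
apply: lime_le.
  by apply: is_cvg_nneseries => i _ _; rewrite lee_fin mulr_ge0// exprn_ge0// ltW.
near=> m; rewrite sumEFin lee_fin.
exact: (geometric_le_lim m A0 z0 z1).
Unshelve. all: by end_near. Qed.

(* The integral is split at x1: below, the integrand is at most l / m0; above, it is within a
   constant factor of the integrand of the critical gap. *)
Lemma integral_ratio_le (x0 x1 l m m0 g : R) :
  c < x0 -> x0 <= x1 -> c < m -> 0 <= l -> 0 < m0 -> m + m0 <= x0 -> m < x1 ->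
  1 <= g -> (x1 - c) <= g * (x1 - m) ->
  (\int[P]_(w in p 0%N @^-1` `]x0, 1%R]) (l * (p 0%N w - m) `^ (-1))%:E <=
   (l / m0 * F x1 + l / c * g * fine (critical_gap F c))%:E)%E.
Proof.
move=> cx0 x01 cm l0 m00 mx0 mx1 g1 hg.
have glty := gap_lty.
have gge0 : (0 <= critical_gap F c)%E.
  by rewrite gapE integral_ge0// => w _; rewrite lee_fin mulr_ge0 ?powR_ge0// ltW.
have gfin : critical_gap F c \is a fin_num by rewrite ge0_fin_numE.
pose f (w : T) : R := l / m0 * \1_(p 0%N @^-1` `]-oo, x1]) w +
  l / c * g * (c * (p 0%N w - c) `^ (-1)).
have mr a b : measurable_fun setT (fun w => a * (p 0%N w - b) `^ (-1)).
  exact: (measurableT_comp (measurable_ratio a b)).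
have mI : measurable (p 0%N @^-1` `]-oo, x1]) by exact: measurable_funPTI.
have m1 : measurable_fun setT (fun w => ((\1_(p 0%N @^-1` `]-oo, x1]) w)%:E : \bar R)).
  by apply/measurable_EFinP; exact: measurable_indic.
have m2 : measurable_fun setT (fun w => ((c * (p 0%N w - c) `^ (-1))%:E : \bar R)).
  by apply/measurable_EFinP; exact: mr.
have k1 : 0 <= l / m0 by rewrite divr_ge0// ltW.
have k2 : 0 <= l / c * g by rewrite mulr_ge0 ?divr_ge0 ?(ltW c0)//; lra.
have r0 (w : T) : (0 <= (c * (p 0%N w - c) `^ (-1))%:E)%E.
  by rewrite lee_fin mulr_ge0 ?powR_ge0// ltW.
pose D := p 0%N @^-1` `]c, 1%R].
have mD : measurable D by exact: measurable_funPTI.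
apply: (@le_trans _ _ (\int[P]_(w in D) ((l / m0)%:E * (\1_(p 0%N @^-1` `]-oo, x1]) w)%:E +
  (l / c * g)%:E * (c * (p 0%N w - c) `^ (-1))%:E))%E).
  apply: (@le_trans _ _ (\int[P]_(w in p 0%N @^-1` `]x0, 1%R])
    ((l / m0)%:E * (\1_(p 0%N @^-1` `]-oo, x1]) w)%:E +
    (l / c * g)%:E * (c * (p 0%N w - c) `^ (-1))%:E))%E); last first.
    apply: ge0_subset_integral => //.
    - exact: measurable_funPTI.
    - apply: measurable_funTS; apply: emeasurable_funD;
        by apply: emeasurable_funM => //; exact: measurable_cst.
    - by move=> w _; rewrite adde_ge0// mule_ge0// lee_fin.
    - by move=> w; rewrite /D /= !in_itv /= => /andP[h h1]; rewrite h1 (lt_trans cx0 h).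
  apply: ge0_le_integral => //.
  - exact: measurable_funPTI.
  - by move=> w _; rewrite lee_fin mulr_ge0 ?powR_ge0.
  - by apply/measurable_EFinP; apply: measurable_funTS; exact: mr.
  - apply: measurable_funTS; apply: emeasurable_funD;
      by apply: emeasurable_funM => //; exact: measurable_cst.
  move=> w; rewrite /= in_itv /= => /andP[x0w w1].
  rewrite -!EFinM -EFinD lee_fin; set y := p 0%N w in x0w w1 *.
  have ym : 0 < y - m by lra.
  have yc : 0 < y - c by lra.
  have ry0 : 0 <= c / (y - c) by rewrite divr_ge0 // ltW.
  rewrite !powR_inv1 ?(ltW ym) ?(ltW yc)//.
  have [yx1|x1y] := leP y x1.
    rewrite indicE mem_set ?mulr1; last by rewrite /= in_itv /= -/y.
    rewrite -[leLHS]addr0; apply: lerD; last exact: mulr_ge0.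
    by apply: ler_wpM2l => //; rewrite lef_pV2 ?posrE//; lra.
  rewrite -[leLHS]add0r; apply: lerD; first exact: mulr_ge0.
  (* Since g >= 1, the inequality x1 - c <= g (x1 - m) extends from x1 to every y >= x1. *)
  have -> : l / c * g * (c / (y - c)) = l * (g / (y - c)).
    by field; rewrite !gt_eqF.
  apply: ler_wpM2l => //; rewrite ler_pdivlMr// mulrC ler_pdivrMr//; nra.
have p1 : measurable_fun D (fun w => ((l / m0)%:E * (\1_(p 0%N @^-1` `]-oo, x1]) w)%:E)%E).
  by apply: measurable_funTS; apply: emeasurable_funM => //; exact: measurable_cst.
have p2 : measurable_fun D (fun w => ((l / c * g)%:E * (c * (p 0%N w - c) `^ (-1))%:E)%E).
  by apply: measurable_funTS; apply: emeasurable_funM => //; exact: measurable_cst.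
rewrite ge0_integralD//; last 2 first.
- by move=> w _; rewrite mule_ge0// lee_fin.
- by move=> w _; rewrite mule_ge0// lee_fin.
rewrite EFinD; apply: leeD.
  rewrite ge0_integralZl_EFin//; last exact: measurable_funTS.
  rewrite [leRHS]EFinM; apply: lee_wpmul2l; first by rewrite lee_fin.
  rewrite integral_indic// -(rate_cdf_le hp 0).
  by apply: le_measure; rewrite ?inE//; exact: measurableI.
rewrite ge0_integralZl_EFin//; last exact: measurable_funTS.
by rewrite -gapE [leRHS]EFinM fineK.
Qed.

End gap_integral.

(** * Explicit form of the lower bound *)

Section explicit_lower_bound.
Context {R : realType} {d : measure_display} {T : measurableType d}.
Variable P : probability T R.
Variables (F : cumulativeBounded (0 : R) (1 : R)) (p : nat -> {RV P >-> R}).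
Variables (N : nat -> R -> {RV P >-> nat}) (xi : nat -> R -> T -> int).
Hypothesis process : disordered_exclusion F p N xi.

Lemma expRN_le (u : R) : 0 <= u -> expR (- u) <= 1 - u + u ^+ 2.
Proof.
move=> u0; rewrite expRN; apply: (@le_trans _ _ (1 + u)^-1).
  by rewrite lef_pV2 ?posrE ?expR_gt0 ?expR_ge1Dx//; lra.
have u3 : 0 <= u ^+ 3 by rewrite exprn_ge0.
rewrite -[leLHS]mul1r ler_pdivrMr; last lra.
have -> : (1 - u + u ^+ 2) * (1 + u) = 1 + u ^+ 3 by ring.
lra.
Qed.

Lemma expR_sub1_le (u : R) : 0 <= u -> u <= 2^-1 -> expR u - 1 <= u + 2 * u ^+ 2.
Proof.
move=> u0 u1; have h := expR_ge1Dx (- u).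
have e0 : 0 < expR u by exact: expR_gt0.
have : expR u * expR (- u) = 1 by rewrite expRN divff// gt_eqF.
nra.
Qed.

(** Makes the bound on [queue_gen] affine in the ratio lam / (y - lam'), so that its average over a
    rate is controlled by the integral of that ratio. *)
Lemma inv_one_sub_le (eps X : R) : 0 < eps -> 0 <= X -> (1 + eps) * X <= eps ->
  (1 - X)^-1 <= 1 + (1 + eps) * X.
Proof.
move=> e0 X0 hX; have X1 : X < 1 by nra.
rewrite -[leLHS]mul1r ler_pdivrMr ?subr_gt0//; nra.
Qed.

(** The leader jumps with probability a = lam delta per step, so M a = lam t. The quotient a / (q -
    a) becomes at most lam / (y - lam'), and both products are bounded by exponentials. The margin
    m0 between lam' and the rates keeps the generating functions finite. *)
Lemma beyond_ge_explicit (c t lam lam' m0 x0 theta eps r1 r2 U : R) (n M : nat) :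
  let delta := t / M%:R in let sig := expR theta - 1 in
  0 < t -> (0 < M)%N -> 0 < lam -> lam <= 1 -> lam * delta <= 1 ->
  lam + delta <= lam' -> 0 < m0 -> lam' + m0 <= x0 -> x0 <= 1 ->
  0 <= theta -> 0 < eps -> (1 + eps) * (sig * lam) <= eps * m0 ->
  r1 - r2 = c * t + n%:R -> F 1 = 1 -> 0 <= U ->
  (\int[P]_(w in p 0%N @^-1` `]x0, 1%R]) (lam * (p 0%N w - lam') `^ (-1))%:E <= U%:E)%E ->
  (((1 - F x0) ^+ n.+1)%:E <= P [set w | (c * t < (xi n t w)%:~R)%R] +
    (expR (theta * (r1 - lam * t) + t * theta ^+ 2) +
     expR (- (theta * r2) + n.+1%:R * (sig * (lam * delta + (1 + eps) * U))))%:E)%E.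
Proof.
move=> delta sig t0 M0 lam0 lam1 ld1 ldl m00 lmx x01 th0 eps0 hsig r12 F1 U0 hU.
have M0' : 0 < M%:R :> R by rewrite ltr0n.
have delta0 : 0 < delta by rewrite divr_gt0.
have sig0 : 0 <= sig by rewrite subr_ge0 -expR0 ler_expR.
pose a := lam * delta.
have a0 : 0 < a by rewrite mulr_gt0.
pose q (y : R) := 1 - expR (- (y * delta)).
(* The second order error of the ring probability is at most delta^2; the gap lam' - lam >= delta
   absorbs it. *)
have qa y : x0 < y -> y <= 1 -> delta * (y - lam') <= q y - a.
  move=> xy y1; have yd : 0 <= y * delta by rewrite mulr_ge0 ?(ltW delta0)//; lra.
  have h := expRN_le yd.
  have h2 : (y * delta) ^+ 2 <= delta ^+ 2.
    rewrite ler_pXn2r ?nnegrE ?(ltW delta0)// ler_piMl ?(ltW delta0)//.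
  rewrite /q /a; nra.
pose h (y : R) := \1_`]x0, 1%R] y *
  ((1 + sig * a) * (1 + (1 + eps) * sig * (lam * (y - lam') `^ (-1)))).
have sa0 : 0 <= sig * a by rewrite mulr_ge0// ltW.
have hy0 y : 0 <= (1 + sig * a) * (1 + (1 + eps) * sig * (lam * (y - lam') `^ (-1))).
  by rewrite mulr_ge0 ?addr_ge0// mulr_ge0 ?mulr_ge0 ?powR_ge0//; lra.
have hE y : x0 < y -> y <= 1 -> h y =
    (1 + sig * a) * (1 + (1 + eps) * sig * (lam / (y - lam'))).
  move=> xy y1; rewrite /h indicE mem_set ?mul1r; last by rewrite /= in_itv /= xy y1.
  by rewrite powR_inv1//; lra.
have h0 y : 0 <= h y by rewrite /h mulr_ge0.
pose C := (1 + sig * a) * (1 + (1 + eps) * sig * (lam / m0)).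
have C0 : 0 <= C by rewrite mulr_ge0 ?addr_ge0// mulr_ge0 ?mulr_ge0 ?invr_ge0//; lra.
have hC y : h y <= C.
  have [/andP[xy y1]|/negP ny] := boolP ((x0 < y) && (y <= 1)).
    rewrite hE// /C; apply: ler_wpM2l; first by rewrite addr_ge0.
    rewrite lerD2l; apply: ler_wpM2l; first by apply: mulr_ge0 => //; lra.
    by apply: ler_wpM2l; [exact: ltW|rewrite lef_pV2 ?posrE//; lra].
  by rewrite /h indicE memNset ?mul0r//= in_itv.
have mh : measurable_fun setT h.
  apply: measurable_funM; first exact: measurable_indic.
  apply: measurable_funM; first exact: measurable_cst.
  apply: measurable_funD; first exact: measurable_cst.
  apply: measurable_funM; first exact: measurable_cst.
  exact: measurable_ratio.
have hqh y : x0 < y -> y <= 1 -> queue_gen a (expR theta) (q y) <= h y.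
  move=> xy y1; rewrite hE// /queue_gen -/sig; have hqa := qa y xy y1.
  have yl : 0 < y - lam' by lra.
  have X1 : sig * (a / (q y - a)) <= sig * (lam / (y - lam')).
    rewrite ler_wpM2l// ler_pdivrMr; last by rewrite (lt_le_trans _ hqa)// mulr_gt0.
    rewrite mulrAC ler_pdivlMr// /a -mulrA ler_wpM2l ?(ltW lam0)//.
  have X0 : 0 <= sig * (lam / (y - lam')) by rewrite mulr_ge0// divr_ge0// ltW.
  have X2 : (1 + eps) * (sig * (lam / (y - lam'))) <= eps.
    rewrite !mulrA ler_pdivrMr// -mulrA (le_trans hsig)// ler_wpM2l ?(ltW eps0)//; lra.
  have X3 : sig * (lam / (y - lam')) < 1 by nra.
  rewrite ler_wpM2l ?addr_ge0// -mulrA; apply: le_trans (inv_one_sub_le eps0 X0 X2).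
  by rewrite lef_pV2 ?posrE//; lra.
pose gam := (1 + sig * a) * (1 + (1 + eps) * sig * U).
have gam0 : 0 <= gam by rewrite mulr_ge0 ?addr_ge0// mulr_ge0 ?mulr_ge0//; lra.
have hq y : x0 < y -> y <= 1 -> a < q y /\ (expR theta - 1) * a < q y - a.
  move=> xy y1; have hqa := qa y xy y1.
  have h1 : delta * m0 <= delta * (y - lam') by rewrite ler_wpM2l ?(ltW delta0)//; lra.
  have h2 : 0 < delta * m0 by rewrite mulr_gt0.
  split; first lra.
  rewrite -/sig /a; have h3 : sig * lam < m0 by have := mulr_ge0 sig0 (ltW lam0); nra.
  rewrite /a in hqa; have : sig * lam * delta < m0 * delta by rewrite ltr_pM2r.
  lra.
pose D := p 0%N @^-1` `]x0, 1%R].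
have mD : measurable D by exact: measurable_funPTI.
have hint : (\int[P]_w (h (p 0%N w))%:E <= gam%:E)%E.
  have k0 : 0 <= 1 + sig * a by rewrite addr_ge0.
  have k1 : 0 <= (1 + eps) * sig by rewrite mulr_ge0//; lra.
  pose k (w : T) := lam * (p 0%N w - lam') `^ (-1).
  have mk : measurable_fun D (fun w => (k w)%:E).
    apply/measurable_EFinP; apply: measurable_funTS.
    exact: (measurableT_comp (measurable_ratio lam lam')).
  have kp w : (0 <= (k w)%:E)%E by rewrite lee_fin mulr_ge0 ?powR_ge0// ltW.
  rewrite [leLHS](_ : _ = \int[P]_(w in D)
      ((1 + sig * a)%:E * (1%:E + ((1 + eps) * sig)%:E * (k w)%:E)))%E; last first.
    rewrite [RHS]integral_mkcond; apply: eq_integral => w _; rewrite patchE /h indicE.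
    have -> : (w \in D) = (p 0%N w \in `]x0, 1%R]%classic) by [].
    case: (p 0%N w \in _); last by rewrite mul0r.
    by rewrite mul1r.
  have m1 : measurable_fun D (fun w => ((1 + eps) * sig)%:E * (k w)%:E)%E.
    by apply: emeasurable_funM => //; exact: measurable_cst.
  have s0 w : D w -> (0 <= ((1 + eps) * sig)%:E * (k w)%:E)%E.
    by move=> _; rewrite mule_ge0// lee_fin.
  rewrite ge0_integralZl_EFin//; last 2 first.
  - by move=> w Dw; rewrite adde_ge0// s0.
  - by apply: emeasurable_funD => //; exact: measurable_cst.
  rewrite [leRHS]EFinM; apply: lee_wpmul2l; first by rewrite lee_fin.
  rewrite ge0_integralD// EFinD; apply: leeD.
    rewrite integral_cst// mul1e; exact: probability_le1.
  rewrite ge0_integralZl_EFin//.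
  by rewrite [leRHS]EFinM; apply: lee_wpmul2l; first by rewrite lee_fin.
have x00 : 0 <= x0 by lra.
apply: le_trans (le_trans _ (beyond_ge process x00 x01 t0 M0 a0 ld1 th0 gam0 r12 hq mh h0 hC hqh hint)) _.
  by rewrite F1.
apply: leeD => //; rewrite lee_fin lerD//.
  have e1 : 1 - a + a * expR (- theta) <= expR (- (a * (theta - theta ^+ 2))).
    apply: le_trans (expR_ge1Dx _); have h1 := expRN_le th0.
    have : a * expR (- theta) <= a * (1 - theta + theta ^+ 2) by rewrite ler_wpM2l// ltW.
    lra.
  have e0 : 0 <= 1 - a + a * expR (- theta).
    by rewrite addr_ge0 ?subr_ge0// mulr_ge0 ?expR_ge0// ltW.
  apply: (@le_trans _ _ (expR (theta * r1) * expR (- (a * (theta - theta ^+ 2))) ^+ M)).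
    by rewrite ler_wpM2l ?expR_ge0// lerXn2r ?nnegrE ?expR_ge0.
  rewrite -expRM_natl -expRD ler_expR.
  have aM : M%:R * a = lam * t by rewrite /a /delta; field; rewrite gt_eqF.
  have -> : M%:R * - (a * (theta - theta ^+ 2)) = - (lam * t * (theta - theta ^+ 2)).
    by rewrite -aM; ring.
  have : lam * t * theta ^+ 2 <= t * theta ^+ 2.
    by rewrite ler_wpM2r ?exprn_ge0// ler_piMl// ltW.
  lra.
rewrite expRD ler_wpM2l ?expR_ge0// expRM_natl lerXn2r ?nnegrE ?expR_ge0//.
have -> : sig * (lam * delta + (1 + eps) * U) = sig * a + (1 + eps) * sig * U.
  by rewrite /a; ring.
rewrite /gam expRD; apply: ler_pM; rewrite ?expR_ge1Dx ?addr_ge0//.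
by rewrite mulr_ge0 ?mulr_ge0//; lra.
Qed.

End explicit_lower_bound.

(** * Limits in time *)

Section limits.
Context {R : realType}.

Lemma limf_esup_le (f : R -> \bar R) (g : R -> R) (l : R) :
  (\forall t \near +oo, (f t <= (g t)%:E)%E) -> g t @[t --> +oo] --> l ->
  (limf_esup f +oo%R <= l%:E)%E.
Proof.
move=> fg gl; apply/lee_addgt0Pr => e e0.
have /cvgr_le/(_ (l + e)) := gl; rewrite ltrDl => /(_ e0) gle.
have /= hV := filterI fg gle.
set V := (X in nbhs _ X) in hV.
rewrite limf_esupE; apply: (@le_trans _ _ (ereal_sup (f @` V))).
  by apply: ereal_inf_lbound; exists V; [exact: hV|].
apply: ub_ereal_sup => _ [t [ht1 ht2] <-]; apply: le_trans ht1 _.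
by rewrite -EFinD lee_fin.
Qed.

Lemma limf_einf_ge (f : R -> \bar R) (g : R -> R) (l : R) :
  (\forall t \near +oo, ((g t)%:E <= f t)%E) -> g t @[t --> +oo] --> l ->
  (l%:E <= limf_einf f +oo%R)%E.
Proof.
move=> fg gl; rewrite /limf_einf leeNr.
apply: (limf_esup_le (g := fun t => - g t)); last exact: cvgN.
by apply: filterS fg => t; rewrite EFinN leeN2.
Qed.

Lemma near_pinfty_gt (r : R) : \forall t \near +oo, r < t.
Proof. by apply: nbhs_pinfty_gt; exact: num_real. Qed.

Lemma near_pinfty_ge (r : R) : \forall t \near +oo, r <= t.
Proof. by apply: nbhs_pinfty_ge; exact: num_real. Qed.

Lemma powR_cvgy (a : R) : 0 < a -> t `^ a @[t --> +oo] --> +oo.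
Proof.
move=> a0; apply/cvgryPge => A.
near=> t.
have t0 : 0 < t by near: t; exact: near_pinfty_gt.
have tA : Num.max A 1 `^ a^-1 <= t by near: t; exact: near_pinfty_ge.
apply: (@le_trans _ _ (Num.max A 1)); first by rewrite le_max lexx.
have m0 : 0 <= Num.max A 1 by rewrite le_max ler01 orbT.
have -> : Num.max A 1 = (Num.max A 1 `^ a^-1) `^ a.
  by rewrite -powRrM mulVf ?gt_eqF// powRr1.
by apply: ge0_ler_powR; rewrite ?nnegrE ?powR_ge0// ltW.
Unshelve. all: by end_near. Qed.

Lemma powRN_cvg0 (a : R) : 0 < a -> t `^ (- a) @[t --> +oo] --> 0.
Proof.
move=> a0; have /cvgryPge h := powR_cvgy a0.
apply/cvgrPdist_le => e e0; near=> t.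
have te : e^-1 <= t `^ a by near: t; exact: h.
rewrite sub0r normrN powRN ger0_norm ?invr_ge0 ?powR_ge0//.
by rewrite -[leRHS]invrK lef_pV2 ?posrE ?invr_gt0// (lt_le_trans _ te)// invr_gt0.
Unshelve. all: by end_near. Qed.

Variables (F : R -> R) (c nu kappa : R).
Hypotheses (nu0 : 0 < nu).
Hypothesis F_tail : F x / (x - c) `^ (nu + 1) @[x --> c^'+] --> kappa.

Let tau (t : R) := t `^ (- alpha nu).
Let T (t : R) := t `^ (1 - alpha nu).

Lemma alpha_itv : 0 < alpha nu < 2^-1.
Proof.
have n0 := nu0; apply/andP; split; rewrite /alpha; first by rewrite invr_gt0; lra.
by rewrite ltf_pV2 ?posrE; lra.
Qed.

Lemma scaleE t : 0 < t -> T t = t * tau t.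
Proof.
move=> t0; rewrite /T /tau powRD; last by rewrite (gt_eqF t0) implybT.
by rewrite powRr1// ltW.
Qed.

Lemma scale_tau t : 0 < t -> T t * tau t `^ (nu + 1) = 1.
Proof.
move=> t0; rewrite /T /tau -powRrM -powRD; last by rewrite (gt_eqF t0) implybT.
have -> : 1 - alpha nu + - alpha nu * (nu + 1) = 0.
  by rewrite /alpha; field; rewrite gt_eqF//; have := nu0; lra.
by rewrite powRr0.
Qed.

Lemma tau_gt0 t : 0 < t -> 0 < tau t. Proof. exact: powR_gt0. Qed.

Lemma tau_cvg0 : tau t @[t --> +oo] --> 0.
Proof. by apply: powRN_cvg0; have /andP[] := alpha_itv. Qed.

Lemma T_cvgy : T t @[t --> +oo] --> +oo.
Proof. by apply: powR_cvgy; have /andP[] := alpha_itv; lra. Qed.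

Lemma near_tau_lt e : 0 < e -> \forall t \near +oo, tau t < e.
Proof. by move=> e0; have /cvgr_lt/(_ e e0) := tau_cvg0. Qed.

Lemma count_ratio_cvg b : 0 < b ->
  (Num.truncn (b * T t)).+1%:R / T t @[t --> +oo] --> b.
Proof.
move=> b0.
have hT : (T t)^-1 @[t --> +oo] --> 0.
  apply: cvg_trans (powRN_cvg0 (a := 1 - alpha nu) _); last first.
    by have /andP[] := alpha_itv; lra.
  by apply: near_eq_cvg; near=> t; rewrite powRN.
have h2 : b + (T t)^-1 @[t --> +oo] --> b.
  by rewrite -[X in _ --> X]addr0; apply: cvgD hT; exact: cvg_cst.
apply: (squeeze_cvgr _ (cvg_cst b) h2).
near=> t.
have t0 : 0 < t by near: t; exact: near_pinfty_gt.
have T0 : 0 < T t by exact: powR_gt0.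
have bT : 0 <= b * T t by rewrite mulr_ge0// ltW.
have /andP[h3 h4] := truncn_itv bT.
rewrite /= ler_pdivlMr// (ltW h4) ler_pdivrMr// mulrDl mulVf ?gt_eqF//.
by rewrite -natr1 lerD2r.
Unshelve. all: by end_near. Qed.

Lemma count_tail_cvg b y : 0 < b -> 0 < y ->
  (Num.truncn (b * T t)).+1%:R * F (c + y * tau t) @[t --> +oo] -->
  b * kappa * y `^ (nu + 1).
Proof.
move=> b0 y0.
have h1 : F (c + y * tau t) / (y * tau t) `^ (nu + 1) @[t --> +oo] --> kappa.
  have hc : (c + y * tau t) @[t --> +oo] --> c^'+.
    move=> A [e /= e0 he].
    have ey : 0 < e / y by rewrite divr_gt0.
    change (\forall t \near +oo, A (c + y * tau t)).
    near=> t.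
    have t0 : 0 < t by near: t; exact: near_pinfty_gt.
    have te : tau t < e / y by near: t; exact: near_tau_lt.
    have yt : 0 < y * tau t by rewrite mulr_gt0// tau_gt0.
    apply: he => /=; last by rewrite ltrDl.
    by rewrite opprD addrA subrr sub0r normrN gtr0_norm// mulrC -ltr_pdivlMr.
  have hcomp := cvg_comp _ _ hc F_tail.
  apply: (cvg_trans _ hcomp); apply: near_eq_cvg.
  near=> t; rewrite /=; congr (_ / _ `^ _); lra.
have h2 : (Num.truncn (b * T t)).+1%:R / T t *
    (F (c + y * tau t) / (y * tau t) `^ (nu + 1)) * y `^ (nu + 1) @[t --> +oo] -->
    b * kappa * y `^ (nu + 1).
  by apply: cvgM; [apply: cvgM => //; exact: count_ratio_cvg|exact: cvg_cst].
apply: (cvg_trans _ h2); apply: near_eq_cvg; near=> t.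
have t0 : 0 < t by near: t; exact: near_pinfty_gt.
have T0 : 0 < T t by exact: powR_gt0.
have tt := tau_gt0 t0; have := scale_tau t0.
rewrite /= powRM ?(ltW y0) ?(ltW tt)//.
have yp : 0 < y `^ (nu + 1) by exact: powR_gt0.
have tp : 0 < tau t `^ (nu + 1) by exact: powR_gt0.
move: (tau t `^ _) tp (y `^ _) yp (T t) T0 (F _) (_.+1%:R) => a a0 y' y'0 T' T'0 f k e.
have -> : a = T'^-1 by rewrite -[LHS]mul1r -(mulVf (lt0r_neq0 T'0)) -mulrA e mulr1.
by field; rewrite !gt_eqF.
Unshelve. all: by end_near. Qed.

End limits.

Lemma rear_position_le (X Y : int) (j m v : nat) : (j < m.+1)%N ->
  X + (m - j)%N%:Z <= Y -> Y <= - j%:Z + v%:Z -> X + m%:Z <= v%:Z.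
Proof. lia. Qed.

Lemma expR_sub1_small {R : realType} (th eps : R) : 0 < th -> th < eps / 2 -> eps <= 1 ->
  expR th - 1 <= th * (1 + eps).
Proof.
move=> th0 th2 eps1; have h1 : th <= 2^-1 by lra.
have := expR_sub1_le (ltW th0) h1.
have : th * th <= th * (eps / 2) by rewrite ler_wpM2l// ltW.
by rewrite expr2; lra.
Qed.

Lemma scaled_sig_le {R : realType} (sig th lam eps m0 : R) : 0 <= sig -> 0 <= th ->
  0 <= lam -> lam <= 1 -> 0 <= eps -> eps <= 1 -> sig <= th * (1 + eps) ->
  th * 4 <= m0 -> (1 + eps) * (sig * lam) <= m0.
Proof.
move=> s0 th0 l0 l1 e0 e1 hs hm.
have h2 : sig * lam <= th * (1 + eps) by apply: le_trans hs; rewrite ler_piMr.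
have h3 : (1 + eps) * (sig * lam) <= (1 + eps) * (th * (1 + eps)).
  by rewrite ler_wpM2l//; lra.
have h5 : th * (eps * eps) <= th * eps by rewrite ler_wpM2l// ler_piMl.
have h6 : th * eps <= th by rewrite ler_piMr.
lra.
Qed.

Lemma gap_perturbation_le {R : realType} (c z tau u eps g A : R) :
  0 < c -> 0 < z -> 0 < tau -> 0 <= u -> 0 <= eps -> eps <= 1 ->
  g * u <= u + eps / 2 -> A <= eps -> tau < eps / 2 * c / (z * (u + 1)) ->
  A + (c + z * tau) / c * g * u <= u + 2 * eps.
Proof.
move=> c0 z0 t0 u0 e0 e1 gu hA.
have zu : 0 < z * (u + 1) by rewrite mulr_gt0//; lra.
rewrite ltr_pdivlMr// => ht.
have h3 : z * tau / c * (u + 1) <= eps / 2.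
  rewrite mulrAC ler_pdivrMr//; lra.
have h4 : (c + z * tau) / c * g * u = g * u + z * tau / c * (g * u).
  by field; rewrite gt_eqF.
have h5 : z * tau / c * (g * u) <= z * tau / c * (u + 1).
  by rewrite ler_wpM2l ?divr_ge0 ?mulr_ge0 ?(ltW z0) ?(ltW t0) ?(ltW c0)//; lra.
lra.
Qed.

(** In units of th S, the allowed lag r2 brings z - eps - b, and the k queues cost at most the left
    side of the last hypothesis. That hypothesis leaves a margin eps. *)
Lemma queue_exponent_le {R : realType} (th S r2 b z u eps k sig ld U : R) :
  (z - eps - b) * S <= r2 -> 0 <= ld -> 0 <= th -> 0 <= S -> 0 <= eps ->
  k <= (b + eps) * S -> 0 <= k -> 0 <= sig -> sig <= th * (1 + eps) ->
  ld <= eps -> 0 <= U -> U <= u + 2 * eps ->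
  (b + eps) * ((1 + eps) * (eps + (1 + eps) * (u + 2 * eps))) <= z - eps - b - eps ->
  - (th * r2) + k * (sig * (ld + (1 + eps) * U)) <= - (eps * (th * S)).
Proof.
move=> hr ld0 th0 S0 e0 hk k0 s0 hs hld U0 hU hq.
have h1 : th * ((z - eps - b) * S) <= th * r2 by rewrite ler_wpM2l.
have h3 : ld + (1 + eps) * U <= eps + (1 + eps) * (u + 2 * eps).
  by apply: lerD => //; rewrite ler_wpM2l//; lra.
have h30 : 0 <= ld + (1 + eps) * U by rewrite addr_ge0// mulr_ge0//; lra.
have h4 : sig * (ld + (1 + eps) * U) <=
    th * (1 + eps) * (eps + (1 + eps) * (u + 2 * eps)) by exact: ler_pM.
have h5 : k * (sig * (ld + (1 + eps) * U)) <=
    (b + eps) * S * (th * (1 + eps) * (eps + (1 + eps) * (u + 2 * eps))).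
  by apply: ler_pM => //; exact: mulr_ge0.
have h6 : (b + eps) * S * (th * (1 + eps) * (eps + (1 + eps) * (u + 2 * eps))) =
    (b + eps) * ((1 + eps) * (eps + (1 + eps) * (u + 2 * eps))) * (th * S) by ring.
have h7 := ler_wpM2r (mulr_ge0 th0 S0) hq.
lra.
Qed.

(** * The two asymptotic estimates *)

Section main_limits.
Context {R : realType} {d : measure_display} {T : measurableType d}.
Variable P : probability T R.
Variables (F : cumulativeBounded (0 : R) (1 : R)) (p : nat -> {RV P >-> R}).
Variables (N : nat -> R -> {RV P >-> nat}) (xi : nat -> R -> T -> int).
Hypothesis process : disordered_exclusion F p N xi.
Variables (c nu kappa : R).
Hypotheses (c0 : 0 < c) (F_supp : supported_on_oc F c) (nu0 : 0 < nu) (kappa0 : 0 < kappa).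
Hypothesis F_tail : F x / (x - c) `^ (nu + 1) @[x --> c^'+] --> kappa.

Let tau (t : R) := t `^ (- alpha nu).
Let S (t : R) := t `^ (1 - alpha nu).
(* With the Chernoff parameter theta, the exponents are of order
   W = theta * S -> oo, while the quadratic corrections t * theta ^ 2 stay bounded. *)
Let theta (t : R) := t `^ (- 2^-1).
Let W (t : R) := t `^ (2^-1 - alpha nu).

Let thetaS t : 0 < t -> theta t * S t = W t.
Proof.
move=> t0; rewrite /theta /S -powRD; last by rewrite (gt_eqF t0) implybT.
by rewrite /W; congr (_ `^ _); lra.
Qed.

Let theta2 t : 0 < t -> t * theta t ^+ 2 = 1.
Proof.
move=> t0; rewrite /theta expr2 -powRD; last by rewrite (gt_eqF t0) implybT.
have -> : - 2^-1 + - 2^-1 = -1 :> R by lra.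
by rewrite powR_inv1 ?(ltW t0)// divff// gt_eqF.
Qed.

Let thetaW t : 0 < t -> theta t * W t = tau t.
Proof.
move=> t0; rewrite /theta /W -powRD; last by rewrite (gt_eqF t0) implybT.
by congr (_ `^ _); lra.
Qed.

Let nearW r : \forall t \near +oo, r <= W t.
Proof.
have /cvgryPge : W t @[t --> +oo] --> +oo; last exact.
by apply: powR_cvgy; have /andP[_] := alpha_itv nu0; lra.
Qed.

Let near_theta e : 0 < e -> \forall t \near +oo, theta t < e.
Proof.
move=> e0; have h : theta t @[t --> +oo] --> 0 by apply: powRN_cvg0; rewrite invr_gt0.
by have /cvgr_lt/(_ e e0) := h.
Qed.

Let expW_cvg0 (C k : R) : 0 < k -> expR (C - k * W t) @[t --> +oo] --> 0.
Proof.
move=> k0; have h : k * W t @[t --> +oo] --> +oo.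
  apply/cvgryPge => A; near=> t.
  have h : k^-1 * A <= W t by near: t; exact: nearW.
  by rewrite mulrC -ler_pdivrMr// mulrC.
have h1 : expR (- (k * W t)) @[t --> +oo] --> 0 by exact: (cvg_comp _ _ h (@cvgr_expR R)).
have h2 : expR C * expR (- (k * W t)) @[t --> +oo] --> expR C * 0.
  by apply: cvgM h1; exact: cvg_cst.
by rewrite mulr0 in h2; under eq_fun do rewrite expRD.
Unshelve. all: by end_near. Qed.

(** A clock of rate c + s b tau rings about ct + s b S times, short by (1 - s) b S of the ct + n
    required. Each of the n + 1 slow clocks therefore fails except with probability [eps t], which
    tends to 0. *)
Lemma esup_beyond_le (b s : R) : 0 < b -> 0 < s -> s < 1 ->
  (limf_esup (fun t : R => P [set w |
      ((b * t `^ (1 - alpha nu))%:E < num_beyond c (fun k s => xi k s w) t)%E]) +oo%R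
   <= (expR (- (b * kappa * (s * b) `^ (nu + 1))))%:E)%E.
Proof.
move=> b0 s0 s1; have sb0 : 0 < s * b by exact: mulr_gt0.
have hp := rates_iid process; have hN := clocks_poisson process.
have [_ Fc _ _] := F_supp; have c1 := left_endpoint_lt1 F_supp.
pose k := (1 - s) * b; have k0 : 0 < k by rewrite mulr_gt0// subr_gt0.
(* In the constant 3, a 2 comes from the quadratic term of expR (theta t) - 1, using t theta^2 = 1
   and x0 <= 1, and a 1 from rounding b S down to n. *)
pose eps t := expR (3 - k * W t).
pose x0 t := c + s * b * tau t.
pose n t := Num.truncn (b * S t).
apply: (limf_esup_le (g := fun t => expR (- ((1 - eps t) * ((n t).+1%:R * F (x0 t)))))); last first.
  have h1 : (1 - eps t) * ((n t).+1%:R * F (x0 t)) @[t --> +oo] -->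
      (1 - 0) * (b * kappa * (s * b) `^ (nu + 1)).
    apply: cvgM; last exact: count_tail_cvg.
    by apply: cvgB; [exact: cvg_cst|exact: expW_cvg0].
  rewrite subr0 mul1r in h1.
  by apply: (@cvg_comp _ _ _ _ expR _ _ _ (cvgN h1)); exact: continuous_expR.
near=> t.
have t0 : 0 < t by near: t; exact: near_pinfty_gt.
have tt : 0 < tau t by exact: powR_gt0.
have th0 : 0 < theta t by exact: powR_gt0.
have th1 : theta t < 2^-1 by near: t; apply: near_theta; rewrite invr_gt0.
have kW : 3 / k <= W t by near: t; exact: nearW.
have x01 : x0 t <= 1.
  have : tau t < (1 - c) / (s * b).
    by near: t; apply: near_tau_lt => //; rewrite divr_gt0// subr_gt0.
  by rewrite ltr_pdivlMr// /x0; lra.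
have S0 : 0 < S t by exact: powR_gt0.
have bS : 0 <= b * S t by rewrite mulr_ge0// ltW.
have /andP[_ nS] := truncn_itv bS.
have eps1 : eps t <= 1.
  rewrite /eps -[leRHS]expR0 ler_expR subr_le0.
  by rewrite ler_pdivrMr// mulrC in kW.
have St : S t = t * tau t by exact: scaleE.
rewrite (prob_num_beyond process c bS (ltW t0)).
set A := [set w | _].
have mA : measurable A by apply: (measurable_beyond process); exact: ltW.
have hA : {ae P, forall w, A w -> forall j, (j < (n t).+1)%N ->
    c * t + (n t)%:R < (N j t w)%:R}.
  have := positions_dynamics process; have := hN.1; apply: filterS2 => w hn hx Aw j jn.
  have h1 := position_le_rings hn hx j (ltW t0).
  have h2 := positionD_le hx j (n t - j) (ltW t0).
  rewrite subnK// in h2.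
  have := rear_position_le jn h2 h1.
  by rewrite -(ler_int R) rmorphD /=; move: Aw; rewrite /A /=; lra.
have key : expR (x0 t * t * (expR (theta t) - 1) - theta t * (c * t + (n t)%:R)) <= eps t.
  rewrite /eps ler_expR.
  have h1 := expR_sub1_le (ltW th0) (ltW th1).
  have xt0 : 0 <= x0 t * t by rewrite mulr_ge0 ?(ltW t0)// addr_ge0 ?ltW// mulr_gt0.
  have h2 : x0 t * t * (expR (theta t) - 1) <= x0 t * t * (theta t + 2 * theta t ^+ 2).
    by rewrite ler_wpM2l.
  have h3 : x0 t * (t * theta t ^+ 2) <= 1 by rewrite theta2// mulr1.
  have h4 : theta t * (b * S t) <= theta t * ((n t)%:R + 1).
    by rewrite ler_wpM2l ?(ltW th0)// natr1 ltW.
  have h5 : x0 t * t * theta t = theta t * (c * t) + s * b * W t.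
    by rewrite -thetaS// St /x0; ring.
  have h6 : theta t * (b * S t) = b * W t by rewrite -thetaS//; ring.
  rewrite /k; lra.
apply: le_trans (many_rings_le hp hN mA hA (ltW c0) Fc t0 (ltW th0) (expR_ge0 _) eps1 key) _.
rewrite lee_fin.
have -> : - ((1 - eps t) * ((n t).+1%:R * F (x0 t))) =
    (n t).+1%:R * - ((1 - eps t) * F (x0 t)) by ring.
rewrite expRM_natl.
have /andP[F0 F1] := cdf_itv01 hp (x0 t).
have e0 : 0 <= eps t by exact: expR_ge0.
have h0 : 0 <= 1 - (1 - eps t) * F (x0 t) by nra.
by rewrite lerXn2r ?nnegrE ?expR_ge0// (le_trans _ (expR_ge1Dx _)).
Unshelve. all: by end_near. Qed.

Let u : R := fine (critical_gap F c).

Let u_ge0 : 0 <= u.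
Proof. by rewrite /u; exact: (gap_ge0 (rates_iid process) c0). Qed.

(** At eps = 0 the inequality reads b u <= z - b, strict by hypothesis, so a small eps survives. *)
Lemma margin_exists (b z : R) : 0 < b -> (1 + u) * b < z ->
  exists2 eps, 0 < eps <= 1 &
    (b + eps) * ((1 + eps) * (eps + (1 + eps) * (u + 2 * eps))) <= z - eps - b - eps.
Proof.
move=> b0 hz; have u0 := u_ge0.
pose D := z - (1 + u) * b; have D0 : 0 < D by rewrite subr_gt0.
(* q bounds the coefficient of e once every e^2 is replaced by e: b (10 + 3u) and u + (10 + 3u) from
   the product, and 2 from the right side. *)
pose q := 12 + 4 * u + b * (10 + 3 * u).
have q0 : 0 < q by rewrite /q; nra.
exists (Num.min 1 (D / q)); first by rewrite lt_min ltr01 divr_gt0//= ge_min lexx.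
set e := Num.min _ _.
have e1 : e <= 1 by rewrite ge_min lexx.
have e0 : 0 < e by rewrite lt_min ltr01 divr_gt0.
have eD : q * e <= D by rewrite mulrC -ler_pdivlMr// ge_min lexx orbT.
have h1 : (1 + e) * (u + 2 * e) <= u + e * (4 + u) by nra.
have h2 : (1 + e) * (e + (1 + e) * (u + 2 * e)) <= u + e * (10 + 3 * u).
  apply: (@le_trans _ _ ((1 + e) * (u + e * (5 + u)))); first by rewrite ler_pM2l; lra.
  have : e * (e * (5 + u)) <= e * (5 + u) by rewrite ler_piMl// mulr_ge0; lra.
  lra.
apply: (@le_trans _ _ ((b + e) * (u + e * (10 + 3 * u)))); first by rewrite ler_pM2l//; lra.
have : e * (e * (10 + 3 * u)) <= e * (10 + 3 * u) by rewrite ler_piMl// mulr_ge0; lra.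
by move: eD; rewrite /q /D; lra.
Qed.

Let cdf_cvg0 y : 0 < y -> F (c + y * tau t) @[t --> +oo] --> 0.
Proof.
move=> y0; have hp := rates_iid process.
have [C C0 hC] := cdf_power_bound hp nu0 kappa0 F_tail.
have h : C * y `^ (nu + 1) * t `^ (- (1 - alpha nu)) @[t --> +oo] --> C * y `^ (nu + 1) * 0.
  apply: cvgM; first exact: cvg_cst.
  by apply: powRN_cvg0; have /andP[_] := alpha_itv nu0; lra.
rewrite mulr0 in h; apply: (squeeze_cvgr _ (cvg_cst 0) h); near=> t.
have t0 : 0 < t by near: t; exact: near_pinfty_gt.
have tt : 0 < tau t by exact: powR_gt0.
have /andP[-> _] := cdf_itv01 hp (c + y * tau t).
have yt : 0 < y * tau t by exact: mulr_gt0.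
apply: le_trans (hC _ yt) _; rewrite -mulrA ler_wpM2l// powRM ?(ltW y0) ?(ltW tt)//.
rewrite ler_wpM2l ?powR_ge0// powRN -/(S t).
have S0 : 0 < S t by exact: powR_gt0.
by rewrite -[leLHS]mul1r -[X in X * _ <= _](mulVf (lt0r_neq0 S0)) -mulrA (scale_tau nu0 t0) mulr1.
Unshelve. all: by end_near. Qed.

Let cdf_tau_small (L e : R) : 0 < L -> 0 < e -> \forall t \near +oo,
  F (c + L * tau t) <= e * tau t.
Proof.
move=> L0 e0; have hp := rates_iid process.
have [C C0 hC] := cdf_power_bound hp nu0 kappa0 F_tail.
have h : C * L `^ (nu + 1) * t `^ (- (alpha nu * nu)) @[t --> +oo] -->
    C * L `^ (nu + 1) * 0.
  apply: cvgM; first exact: cvg_cst.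
  by apply: powRN_cvg0; rewrite mulr_gt0//; have /andP[] := alpha_itv nu0.
rewrite mulr0 in h; have /cvgr_lt/(_ e e0) hlt := h; near=> t.
have t0 : 0 < t by near: t; exact: near_pinfty_gt.
have tt : 0 < tau t by exact: powR_gt0.
have /ltW he : C * L `^ (nu + 1) * t `^ (- (alpha nu * nu)) < e by near: t; exact: hlt.
apply: le_trans (hC _ (mulr_gt0 L0 tt)) _.
rewrite powRM ?(ltW L0) ?(ltW tt)//.
have -> : tau t `^ (nu + 1) = t `^ (- (alpha nu * nu)) * tau t.
  rewrite /tau -powRrM -powRD; last by rewrite (gt_eqF t0) implybT.
  by congr (_ `^ _); ring.
by rewrite !mulrA ler_wpM2r// ltW.
Unshelve. all: by end_near. Qed.

(** Three levels above c, in units of tau: z < z' < y. The leader has speed c + z tau, with z > (1 +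
    u) b to cover the deficit; z' absorbs the time discretization; y bounds the rates from below, at
    distance m1 from z'. *)
Lemma einf_beyond_ge (b y : R) : 0 < b -> (1 + u) * b < y ->
  ((expR (- (b * kappa * y `^ (nu + 1))))%:E <=
   limf_einf (fun t : R => P [set w |
      ((b * t `^ (1 - alpha nu))%:E < num_beyond c (fun k s => xi k s w) t)%E]) +oo%R)%E.
Proof.
move=> b0 by_; have u0 := u_ge0.
have hp := rates_iid process.
have [_ Fc _ F1] := F_supp; have c1 := left_endpoint_lt1 F_supp.
pose z := ((1 + u) * b + y) / 2; pose z' := (z + y) / 2; pose m1 := y - z'.
have ub0 : 0 < (1 + u) * b by rewrite mulr_gt0//; lra.
have zb : (1 + u) * b < z by rewrite /z; lra.
have zz : z < z' by rewrite /z' /z; lra.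
have zy : z' < y by rewrite /z' /z; lra.
have m10 : 0 < m1 by rewrite subr_gt0.
have [eps /andP[eps0 eps1] heps] := margin_exists b0 zb.
(* The gap integral is split at c + L tau. Beyond it, replacing c by lam' in the denominator costs
   at most the factor g = L / (L - z'), and L is large enough for g u <= u + eps / 2. *)
pose L := y + z' + 2 * z' * u / eps.
have ze0 : 0 <= 2 * z' * u / eps by rewrite divr_ge0 ?(ltW eps0)// mulr_ge0//; lra.
pose g := L / (L - z').
have Lz : 0 < L - z' by rewrite /L; lra.
have yL : y <= L by rewrite /L; lra.
have z'0 : 0 < z' by lra.
have L0 : 0 < L by lra.
have gu : g * u <= u + eps / 2.
  have -> : g * u = u + z' * u / (L - z') by rewrite /g; field; rewrite gt_eqF.
  rewrite lerD2l ler_pdivrMr//.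
  have -> : eps / 2 * (L - z') = eps / 2 * y + z' * u by rewrite /L; field; rewrite gt_eqF.
  by rewrite lerDr mulr_ge0//; lra.
have g1 : 1 <= g by rewrite /g ler_pdivlMr// mul1r; lra.
have bound0 : 0 < eps / 2 * c / (z * (u + 1)).
  have u1 : 0 < u + 1 by lra.
  have z0 : 0 < z by lra.
  by rewrite divr_gt0// mulr_gt0// divr_gt0.
pose n t := Num.truncn (b * S t).
pose x0 t := c + y * tau t.
have y0 : 0 < y by lra.
(* With f = F (x0 t), the first term is a lower bound for (1 - f)^(n+1), because 1 / (1 - f) = 1 + f
   / (1 - f) <= exp (f / (1 - f)). The other two are the Chernoff errors of the leader and of the
   queues. *)
apply: (limf_einf_ge (g := fun t => expR (- ((n t).+1%:R * F (x0 t) / (1 - F (x0 t)))) -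
    (expR (1 - eps * W t) + expR (0 - eps * W t)))); last first.
  have h1 : (n t).+1%:R * F (x0 t) / (1 - F (x0 t)) @[t --> +oo] -->
      b * kappa * y `^ (nu + 1) / (1 - 0).
    apply: cvgM; first exact: count_tail_cvg.
    apply: cvgV; first by rewrite subr0 oner_neq0.
    by apply: cvgB; [exact: cvg_cst|exact: cdf_cvg0].
  rewrite subr0 divr1 in h1.
  have h2 : expR (1 - eps * W t) + expR (0 - eps * W t) @[t --> +oo] --> (0 + 0 : R).
    by apply: cvgD; exact: expW_cvg0.
  have h3 : expR (- ((n t).+1%:R * F (x0 t) / (1 - F (x0 t)))) @[t --> +oo] -->
      expR (- (b * kappa * y `^ (nu + 1))).
    by apply: (@cvg_comp _ _ _ _ expR _ _ _ (cvgN h1)); exact: continuous_expR.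
  by have := cvgB h3 h2; rewrite addr0 subr0; exact.
near=> t.
have t0 : 0 < t by near: t; exact: near_pinfty_gt.
have teps : eps^-1 <= t by near: t; exact: near_pinfty_ge.
have tt : 0 < tau t by exact: powR_gt0.
have th0 : 0 < theta t by exact: powR_gt0.
have S0 : 0 < S t by exact: powR_gt0.
have St : S t = t * tau t by exact: scaleE.
have bS : 0 <= b * S t by rewrite mulr_ge0// ltW.
have /andP[nS1 nS2] := truncn_itv bS.
(* time steps of length at most 1 / t, negligible with respect to tau t *)
pose M := (Num.truncn (t ^+ 2)).+1.
pose delta := t / M%:R.
pose lam := c + z * tau t.
pose lam' := c + z' * tau t.
pose m0 := m1 * tau t.
(* The leader may fall eps S short of its mean number of jumps; the lag then allowed is r2 = (z -
   eps) S - n. *)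
pose r1 := lam * t - eps * S t.
pose r2 := r1 - (c * t + (n t)%:R).
pose x1 := c + L * tau t.
pose U := lam / m0 * F x1 + lam / c * g * u.
have M0 : 0 < M%:R :> R by rewrite ltr0n.
have dt : delta <= t^-1.
  rewrite /delta ler_pdivrMr// mulrC ler_pdivlMr// -expr2.
  by apply: ltW; exact: truncnS_gt.
have t1 : 1 <= t by apply: le_trans teps; rewrite invf_ge1.
have tV1 : t^-1 <= 1 by rewrite invf_le1.
have tVeps : t^-1 <= eps by rewrite -[leRHS]invrK lef_pV2 ?posrE ?invr_gt0.
have z0 : 0 < z by exact: lt_trans zb.
have lam0 : 0 < lam by rewrite addr_gt0// mulr_gt0.
have x01 : x0 t <= 1.
  have : tau t < (1 - c) / y.
    by near: t; apply: near_tau_lt => //; rewrite divr_gt0// subr_gt0.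
  by rewrite ltr_pdivlMr// /x0 => h; rewrite -lerBrDl mulrC ltW.
have lam1 : lam <= 1.
  by apply: le_trans x01; rewrite /lam /x0 lerD2l ler_pM2r// ltW// (lt_trans zz).
have d0 : 0 <= delta by rewrite divr_ge0// ltW.
have ld : lam * delta <= eps.
  by apply: le_trans (le_trans dt tVeps); rewrite ler_piMl.
have ld1 : lam * delta <= 1 by exact: le_trans ld eps1.
have ldl : lam + delta <= lam'.
  have hS : (z' - z)^-1 <= S t.
    near: t; have /cvgryPge : S t @[t --> +oo] --> +oo; last exact.
    exact: T_cvgy.
  have /(le_trans dt) : t^-1 <= (z' - z) * tau t.
    rewrite -[leLHS]mul1r ler_pdivrMr// -mulrA [tau t * t]mulrC -St.
    by rewrite mulrC -ler_pdivrMr ?subr_gt0// mul1r.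
  by rewrite mulrBl lerBrDl /lam /lam' -addrA lerD2l.
have m00 : 0 < m0 by rewrite mulr_gt0.
have lmx : lam' + m0 <= x0 t by rewrite le_eqVlt; apply/orP; left; apply/eqP; rewrite /lam' /m0 /m1 /x0; ring.
pose sig := expR (theta t) - 1.
have sig0 : 0 <= sig by rewrite subr_ge0 -expR0 ler_expR ltW.
have th2 : theta t < eps / 2 by near: t; apply: near_theta; rewrite divr_gt0.
have hsig1 : sig <= theta t * (1 + eps) by exact: expR_sub1_small.
have hsig : (1 + eps) * (sig * lam) <= eps * m0.
  have hW : 4 / (eps * m1) <= W t by near: t; exact: nearW.
  have h0 : 4 <= W t * (eps * m1) by rewrite -ler_pdivrMr// mulr_gt0.
  have h1 : theta t * 4 <= theta t * (W t * (eps * m1)) by rewrite ler_wpM2l// ltW.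
  have -> : eps * m0 = theta t * (W t * (eps * m1)) by rewrite /m0 -thetaW//; ring.
  exact: (scaled_sig_le sig0 (ltW th0) (ltW lam0) lam1 (ltW eps0) eps1 hsig1 h1).
have r12 : r1 - r2 = c * t + (n t)%:R by rewrite /r2 opprB addrC subrK.
have /andP[Fx10 _] := cdf_itv01 hp x1.
have U0 : 0 <= U.
  have g0 : 0 <= g by exact: le_trans ler01 g1.
  have [l0 c0' m0'] := And3 (ltW lam0) (ltW c0) (ltW m00).
  by apply: addr_ge0; apply: mulr_ge0 => //; [exact: divr_ge0|rewrite mulr_ge0// divr_ge0].
have hU : U <= u + 2 * eps.
  have h1 : F (c + L * tau t) <= m1 * eps * tau t.
    by near: t; apply: cdf_tau_small; [exact: L0|rewrite mulr_gt0].
  rewrite -/x1 in h1.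
  have h2 : lam / m0 * F x1 <= eps.
    apply: (@le_trans _ _ (1 / m0 * (m1 * eps * tau t))).
      by apply: ler_pM => //; rewrite ?divr_ge0 ?(ltW lam0) ?(ltW m00)// ler_pM2r ?invr_gt0.
    by rewrite le_eqVlt; apply/orP; left; apply/eqP; rewrite /m0; field; rewrite !gt_eqF.
  have h3 : tau t < eps / 2 * c / (z * (u + 1)).
    by near: t; exact: near_tau_lt.
  exact: (gap_perturbation_le c0 z0 tt u0 (ltW eps0) eps1 gu h2 h3).
have hint : (\int[P]_(w in p 0%N @^-1` `]x0 t, 1%R])
    (lam * (p 0%N w - lam') `^ (-1))%:E <= U%:E)%E.
  apply: (integral_ratio_le hp c0 F_supp nu0 kappa0 F_tail) => //.
  - by rewrite /x0 ltrDl mulr_gt0.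
  - by rewrite /x0 /x1 lerD2l ler_pM2r.
  - by rewrite /lam' ltrDl mulr_gt0.
  - exact: ltW.
  - by rewrite /x1 /lam' ltrD2l ltr_pM2r// -subr_gt0.
  - have -> : g * (x1 - lam') = L * tau t by rewrite /g /x1 /lam'; field; rewrite gt_eqF.
    by rewrite /x1 [c + _]addrC addrK.
have := beyond_ge_explicit process t0 (ltn0Sn _ : (0 < M)%N) lam0 lam1 ld1 ldl m00 lmx
  x01 (ltW th0) eps0 hsig r12 F1 U0 hint.
rewrite -/delta -/sig => main.
have /andP[Fx00 _] := cdf_itv01 hp (x0 t).
have Fx01 : F (x0 t) < 1.
  by near: t; have /cvgr_lt/(_ 1 ltr01) := cdf_cvg0 y0.
have hpow : expR (- ((n t).+1%:R * F (x0 t) / (1 - F (x0 t)))) <= (1 - F (x0 t)) ^+ (n t).+1.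
  rewrite -mulrA -mulrN expRM_natl lerXn2r ?nnegrE ?expR_ge0 ?subr_ge0 ?(ltW Fx01)//.
  have f0 : 0 < 1 - F (x0 t) by rewrite subr_gt0.
  rewrite expRN -[leRHS]invrK lef_pV2 ?posrE ?expR_gt0 ?invr_gt0//.
  apply: le_trans (expR_ge1Dx _); rewrite le_eqVlt; apply/orP; left; apply/eqP.
  by field; rewrite gt_eqF.
have WS : theta t * S t = W t by exact: thetaS.
have W0 : 0 < W t by exact: powR_gt0.
have e1 : theta t * (r1 - lam * t) + t * theta t ^+ 2 <= 1 - eps * W t.
  by rewrite theta2// /r1 addrAC subrr sub0r mulrN mulrCA WS addrC.
have hS : eps^-1 <= S t.
  near: t; have /cvgryPge : S t @[t --> +oo] --> +oo; last exact.
  exact: T_cvgy.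
have e2 : - (theta t * r2) + (n t).+1%:R * (sig * (lam * delta + (1 + eps) * U)) <= 0 - eps * W t.
  rewrite sub0r -WS; apply: (queue_exponent_le (b := b) (z := z) (u := u)) => //.
  - have -> : r2 = (z - eps) * S t - (n t)%:R by rewrite /r2 /r1 /lam St; ring.
    by rewrite [_ * S t]mulrBl lerD2l lerN2.
  - by rewrite mulr_ge0 ?(ltW lam0).
  - exact: ltW.
  - exact: ltW.
  - exact: ltW.
  - rewrite mulrDl -natr1 lerD//.
    by rewrite -[eps^-1]mul1r ler_pdivrMr// mulrC in hS.
rewrite (prob_num_beyond process c bS (ltW t0)) EFinB leeBlDr//.
apply: (@le_trans _ _ ((1 - F (x0 t)) ^+ (n t).+1)%:E).
  by rewrite lee_fin.
apply: le_trans main _; apply: leeD => //; rewrite lee_fin.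
by apply: lerD; rewrite ler_expR.
Unshelve. all: by end_near. Qed.

End main_limits.

(** * The constant A(nu) and powers *)

Section constants.
Context {R : realType}.
Implicit Types nu : R.

Lemma Aconst_gt1 nu : 0 < nu -> 1 < Aconst nu.
Proof.
move=> nu0; rewrite /Aconst ltr_pdivlMr ?powR_gt0//; last lra.
have n2 : 0 < nu + 2 by lra.
have -> : (nu + 2) `^ (nu + 2) = (nu + 2) `^ (nu + 1) * (nu + 2).
  rewrite -[X in _ = _ * X](powRr1 (ltW n2)) -powRD; last by rewrite (gt_eqF n2) implybT.
  by congr (_ `^ _); ring.
have n1 : 0 < nu + 1 by lra.
have lt12 : nu + 1 < nu + 2 by lra.
rewrite mul1r; apply: (@lt_le_trans _ _ ((nu + 2) `^ (nu + 1))).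
  by apply: (gt0_ltr_powR n1) => //; rewrite nnegrE ltW.
by rewrite ler_peMr ?powR_ge0//; lra.
Qed.

Lemma powR_root_Aconst nu (A x : R) : 0 < nu -> 0 <= A -> 0 <= x ->
  (A `^ (nu + 1)^-1 * x) `^ (nu + 1) = A * x `^ (nu + 1).
Proof.
move=> nu0 A0 x0; rewrite powRM ?powR_ge0// -powRrM mulVf ?powRr1//.
by rewrite gt_eqF//; lra.
Qed.

Lemma mul_powRS nu (b : R) : 0 < b -> b * b `^ (nu + 1) = b `^ (nu + 2).
Proof.
move=> b0; rewrite -[X in X * _](powRr1 (ltW b0)) -powRD; last by rewrite (gt_eqF b0) implybT.
by congr (_ `^ _); ring.
Qed.

End constants.

Theorem theorem2 (R : realType) (d : measure_display) (T : measurableType d)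
  (P : probability T R) (c nu kappa : R)
  (F : cumulativeBounded (0 : R) (1 : R))
  (p : nat -> {RV P >-> R}) (N : nat -> R -> {RV P >-> nat})
  (xi : nat -> R -> T -> int)
  (c_gt0 : 0 < c) (F_supp : supported_on_oc F c)
  (nu_gt0 : 0 < nu) (kappa_gt0 : 0 < kappa)
  (F_tail : F x / (x - c) `^ (nu + 1) @[x --> c^'+] --> kappa)
  (process : disordered_exclusion F p N xi) :
  (critical_gap F c < +oo)%E /\
  forall b : R, 0 < b ->
    (limf_esup (fun t : R => P [set w |
        ((b * t `^ (1 - alpha nu))%:E
           < num_beyond c (fun k s => xi k s w) t)%E]) +oo%R
     <= (expR (- ((Aconst nu)^-1 * kappa * b `^ (nu + 2))))%:E)%E /\
    ((expR (- (Aconst nu * (1 + fine (critical_gap F c)) `^ (nu + 1)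
                 * kappa * b `^ (nu + 2))))%:E
     <= limf_einf (fun t : R => P [set w |
        ((b * t `^ (1 - alpha nu))%:E
           < num_beyond c (fun k s => xi k s w) t)%E]) +oo%R)%E.
Proof.
split; first exact: (gap_lty (rates_iid process) c_gt0 F_supp nu_gt0 kappa_gt0 F_tail).
move=> b b_gt0.
have A1 := Aconst_gt1 nu_gt0; have A0 : 0 < Aconst nu by exact: lt_trans A1.
have e0 : 0 < (nu + 1)^-1 by rewrite invr_gt0; lra.
split.
  (* Chosen so that s^(nu+1) = 1 / A(nu); it is admissible, s < 1, because A(nu) > 1. *)
  pose s := (Aconst nu)^-1 `^ (nu + 1)^-1.
  have s0 : 0 < s by rewrite powR_gt0 ?invr_gt0.
  have s1 : s < 1.
    have /(gt0_ltr_powR e0) : (Aconst nu)^-1 < 1 by rewrite invf_lt1.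
    by rewrite powR1; apply; rewrite nnegrE ?invr_ge0 ?ler01 ?(ltW A0).
  apply: le_trans (esup_beyond_le process c_gt0 F_supp nu_gt0 F_tail b_gt0 s0 s1) _.
  rewrite /s powR_root_Aconst ?invr_ge0 ?(ltW A0) ?(ltW b_gt0)// -mul_powRS//.
  by rewrite lee_fin ler_expR le_eqVlt; apply/orP; left; apply/eqP; ring.
pose u := fine (critical_gap F c); rewrite -/u.
have u0 : 0 <= u by exact: (gap_ge0 (rates_iid process) c_gt0).
have ub : 0 < (1 + u) * b by rewrite mulr_gt0//; lra.
(* Chosen so that y^(nu+1) = A(nu) ((1 + u) b)^(nu+1); it exceeds (1 + u) b because A(nu) > 1. *)
pose y := Aconst nu `^ (nu + 1)^-1 * ((1 + u) * b).
have hy : (1 + u) * b < y.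
  have /(gt0_ltr_powR e0) := A1.
  by rewrite powR1 /y ltr_pMl//; apply; rewrite nnegrE ?ler01 ?(ltW A0).
apply: le_trans _ (einf_beyond_ge process c_gt0 F_supp nu_gt0 kappa_gt0 F_tail b_gt0 hy).
rewrite /y powR_root_Aconst ?(ltW A0) ?(ltW ub)// powRM ?(ltW b_gt0)//; last lra.
rewrite -mul_powRS// lee_fin ler_expR le_eqVlt; apply/orP; left; apply/eqP; ring.
Qed.
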